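(* (Weak maximum principle) Let $N\ge2$, let $\Omega\subset\mathbb{R}^N$ be a bounded domain and let $M\in\mathbb{R}$. Suppose that $-Q_Nu\le0$ in $\Omega$ and $u\le M$ on $\partial\Omega$. Then $u$ attains its maximum on the boundary, i.e. $u\le M$ a.e. in $\Omega$.
   Context: Let $N\ge 2$ and let $F:\mathbb{R}^N\to[0,\infty)$ be a fixed convex function of class $C^2(\mathbb{R}^N\setminus\{0\})$ with $F(t\xi)=|t|F(\xi)$ for all $t\in\mathbb{R}$, $\xi\in\mathbb{R}^N$, with $F(\xi)>0$ for $\xi\ne0$, and with $\mathrm{Hess}(F^2)$ positive definite in $\mathbb{R}^N\setminus\{0\}$. Write $F_{\xi_i}=\partial F/\partial\xi_i$ and $F_\xi=(F_{\xi_1},\dots,F_{\xi_N})$. The $N$-anisotropic Laplacian is $$Q_N u=\sum_{i=1}^N\frac{\partial}{\partial x_i}\bigl(F^{N-1}(\nabla u)F_{\xi_i}(\nabla u)\bigr),$$ where $F^{N-1}F_\xi$ is taken to be $0$ at the origin. The inequality $-Q_Nu\le0$ is understood in the usual weak sense, $\int_\Omega F^{N-1}(\nabla u)\langle F_\xi(\nabla u),\nabla\varphi\rangle\,dx\le0$ for nonnegative test functions $\varphi$ vanishing on $\partial\Omega$, and boundary inequalities are understood in the Sobolev sense. *)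

(* Defs.v *)
From HB Require Import structures.
From mathcomp Require Import all_boot all_order all_algebra.
From mathcomp Require Import all_classical all_reals all_analysis.

Set Implicit Arguments.
Unset Strict Implicit.
Unset Printing Implicit Defensive.

Import Order.TTheory GRing.Theory Num.Theory.
Import numFieldNormedType.Exports.

Local Open Scope classical_set_scope.
Local Open Scope ring_scope.

(* The Borel sigma-algebra of R^n, generated by the coordinate functions (the
   library provides it for n.-tuple R, but the topology lives on 'rV[R]_n). *)
Section measurable_rV.
Context (R : realType) (n : nat).

Let coord (i : 'I_n) (x : 'rV[R]_n) : R := x ord0 i.

Let rV_set0 : g_sigma_preimage coord set0.
Proof. exact: sigma_algebra0. Qed.

Let rV_setC A : g_sigma_preimage coord A -> g_sigma_preimage coord (~` A).
Proof. exact: sigma_algebraC. Qed.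

Let rV_bigcup (A : (set 'rV[R]_n)^nat) :
  (forall i, g_sigma_preimage coord (A i)) ->
  g_sigma_preimage coord (\bigcup_i A i).
Proof. exact: sigma_algebra_bigcup. Qed.

HB.instance Definition _ := @isMeasurable.Build default_measure_display
  'rV[R]_n (g_sigma_preimage coord) rV_set0 rV_setC rV_bigcup.

Lemma measurable_coord (i : 'I_n) :
  measurable_fun [set: 'rV[R]_n] (fun x : 'rV[R]_n => x ord0 i : R).
Proof.
move=> _ Y mY; rewrite setTI; apply: sub_sigma_algebra => /=.
rewrite -bigcup_seq/=; exists i => /=; first by rewrite mem_index_enum.
by exists Y => //; rewrite setTI.
Qed.

Lemma measurable_fun_coordP d (T : measurableType d) (f : T -> 'rV[R]_n) :
  (forall i, measurable_fun [set: T] (fun x => f x ord0 i : R)) ->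
  measurable_fun [set: T] f.
Proof.
move=> mf.
have sub : g_sigma_preimage coord `<=`
    [set A | measurable (f @^-1` A)].
  apply: smallest_sub.
    split => /=.
    - by rewrite preimage_set0.
    - by move=> A mA; rewrite setTD preimage_setC; exact: measurableC.
    - by move=> A mA; rewrite preimage_bigcup; exact: bigcup_measurable.
  move=> A; rewrite -bigcup_seq/= => -[i _ [Y mY <-]]; rewrite setTI /=.
  by have := mf i measurableT Y mY; rewrite setTI.
by move=> _ Y mY; rewrite setTI; exact: sub.
Qed.

End measurable_rV.

Section lebesgue_rV.
Context (R : realType).
Local Open Scope ereal_scope.

Definition rV_cons n (p : R * 'rV[R]_n) : 'rV[R]_n.+1 :=
  \row_(i < n.+1) if unlift ord0 i is Some j then p.2 ord0 j else p.1.

Lemma measurable_rV_cons n : measurable_fun [set: R * 'rV[R]_n] (@rV_cons n).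
Proof.
apply: measurable_fun_coordP => i; case: (unliftP ord0 i) => [j|] ->.
- rewrite [X in measurable_fun _ X](_ : _ =
      (fun x : 'rV[R]_n => x ord0 j : R) \o snd); last first.
    by apply/funext => p; rewrite /rV_cons mxE liftK.
  by apply: measurableT_comp; [exact: measurable_coord|exact: measurable_snd].
- rewrite [X in measurable_fun _ X](_ : _ = fst); first exact: measurable_fst.
  by apply/funext => p; rewrite /rV_cons mxE unlift_none.
Qed.

Section step.
Context n (mu : {sigma_finite_measure set 'rV[R]_n -> \bar R}).

Definition lebesgue_rV_step : set 'rV[R]_n.+1 -> \bar R :=
  pushforward (@lebesgue_measure R \x mu) (@rV_cons n).

Let step0 : lebesgue_rV_step set0 = 0.
Proof. by rewrite /lebesgue_rV_step /pushforward preimage_set0 measure0. Qed.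

Let step_ge0 A : 0 <= lebesgue_rV_step A.
Proof. exact: (measure_ge0 (@lebesgue_measure R \x mu)). Qed.

Let step_sigma_additive : semi_sigma_additive lebesgue_rV_step.
Proof.
have mpre A : measurable A -> measurable (@rV_cons n @^-1` A).
  by move=> mA; rewrite -[X in measurable X]setTI; exact: measurable_rV_cons.
move=> A mA tA mUA; rewrite /lebesgue_rV_step /pushforward preimage_bigcup.
apply: measure_semi_sigma_additive.
- by move=> k; exact: mpre.
- apply/trivIsetP => /= i j _ _ ij; rewrite -preimage_setI.
  by move/trivIsetP : tA => /(_ _ _ _ _ ij) ->//; rewrite preimage_set0.
- by rewrite -preimage_bigcup; exact: mpre.
Qed.

HB.instance Definition _ := isMeasure.Build _ _ _ lebesgue_rV_step
  step0 step_ge0 step_sigma_additive.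

Let step_sigma_finite : sigma_finite setT lebesgue_rV_step.
Proof.
have /sigma_finiteP[F [TF ndF Foo]] := sigma_finiteT (@lebesgue_measure R).
have /sigma_finiteP[G [TG ndG Goo]] := sigma_finiteT mu.
pose uncons (x : 'rV[R]_n.+1) : R * 'rV[R]_n :=
  (x ord0 ord0, \row_j x ord0 (lift ord0 j)).
have unconsK p : uncons (rV_cons p) = p.
  case: p => a v; rewrite /uncons /rV_cons mxE unlift_none; congr pair.
  by apply/rowP => j; rewrite !mxE liftK.
have muncons : measurable_fun [set: 'rV[R]_n.+1] uncons.
  apply/measurable_fun_pairP; split; first exact: measurable_coord.
  apply: measurable_fun_coordP => j; rewrite [X in measurable_fun _ X](_ : _ =
      (fun x : 'rV[R]_n.+1 => x ord0 (lift ord0 j) : R)).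
    exact: measurable_coord.
  by apply/funext => x /=; rewrite mxE.
exists (fun k => uncons @^-1` (F k `*` G k)).
  apply/esym/seteqP; split => // x _; have : [set: _] (uncons x).1 by [].
  have : [set: _] (uncons x).2 by [].
  rewrite TF TG => -[k _ Gk] [l _ Fl]; exists (maxn k l) => //; split.
  - by move: Fl; exact/subsetPset/ndF/leq_maxr.
  - by move: Gk; exact/subsetPset/ndG/leq_maxl.
move=> k; have [mFk Fk] := Foo k; have [mGk Gk] := Goo k; split.
  by rewrite -[X in measurable X]setTI; apply: muncons => //; exact: measurableX.
rewrite /lebesgue_rV_step /pushforward -comp_preimage.
rewrite (_ : uncons \o _ = id) ?preimage_id; last exact/funext.
by rewrite product_measure1E// lte_mul_pinfty// ge0_fin_numE.
Qed.

HB.instance Definition _ := Measure_isSigmaFinite.Build _ _ _ lebesgue_rV_step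
  step_sigma_finite.

End step.

(* Lebesgue measure on R^n: the n-fold product of lebesgue_measure; see
   lebesgue_rV_box. *)
Fixpoint lebesgue_rV n : {sigma_finite_measure set 'rV[R]_n -> \bar R} :=
  match n with
  | 0 => \d_(0%R : 'rV[R]_0)
  | n'.+1 => lebesgue_rV_step (lebesgue_rV n')
  end.

Lemma lebesgue_rV_box n (A : 'I_n -> set R) :
  (forall i, measurable (A i)) ->
  (lebesgue_rV n [set x | forall i, A i (x ord0 i)] =
   \prod_(i < n) lebesgue_measure (A i)).
Proof.
elim: n A => [|n IHn] A mA.
  by rewrite big_ord0 /= diracE mem_set//= => -[].
rewrite big_ord_recl -IHn; last by move=> i; exact: mA.
have mB : measurable [set x : 'rV[R]_n | forall i, A (lift ord0 i) (x ord0 i)].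
  rewrite (_ : mkset _ =
    \bigcap_(i in [set: 'I_n]) ((fun x : 'rV[R]_n => x ord0 i : R) @^-1` A (lift ord0 i))).
    apply: fin_bigcap_measurable => // i _; rewrite -[X in measurable X]setTI.
    by apply: measurable_coord => //; exact: mA.
  by apply/seteqP; split => x /= h i; [move=> _|]; exact: h.
rewrite -product_measure1E//; last exact: mA.
rewrite /= /lebesgue_rV_step /pushforward; congr (_ _).
apply/seteqP; split => -[a x] /=.
  move=> h; split; first by have := h ord0; rewrite /rV_cons mxE unlift_none.
  by move=> i; have := h (lift ord0 i); rewrite /rV_cons mxE liftK.
by move=> [h1 h2] i; rewrite /rV_cons mxE; case: (unliftP ord0 i) => [j|] -> //=.
Qed.

End lebesgue_rV.

Section calculus.
Context (R : realType) (n : nat).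
Implicit Types (f g : 'rV[R]_n -> R) (U Omega : set 'rV[R]_n).

Definition partial (i : 'I_n) f : 'rV[R]_n -> R := 'D_(delta_mx ord0 i) f.

Definition grad f (x : 'rV[R]_n) : 'rV[R]_n := \row_i partial i f x.

Definition hess f (x : 'rV[R]_n) : 'M[R]_n :=
  \matrix_(i, j) partial i (partial j f) x.

Definition dotp (v w : 'rV[R]_n) : R := \sum_i v ord0 i * w ord0 i.

Definition posdefmx (A : 'M[R]_n) : Prop :=
  forall v : 'rV[R]_n, v != 0 -> 0 < dotp (v *m A) v.

(* Class C^k on an open set U. *)
Fixpoint Ck (k : nat) U f : Prop :=
  (forall x, U x -> {for x, continuous f}) /\
  if k is k'.+1 then
    forall i, (forall x, U x -> derivable f x (delta_mx ord0 i)) /\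
              Ck k' U (partial i f)
  else True.

(* C_c^infty(Omega); such functions are extended by 0 to R^n. *)
Definition test_function Omega f : Prop :=
  (forall k, Ck k setT f) /\
  exists K, [/\ compact K, K `<=` Omega & forall x, ~ K x -> f x = 0].

Definition domain Omega : Prop :=
  [/\ open Omega, connected Omega & Omega !=set0].

End calculus.

Section sobolev.
Context (R : realType) (n : nat).
Implicit Types (Omega : set 'rV[R]_n) (u : 'rV[R]_n -> R)
  (Du : 'rV[R]_n -> 'rV[R]_n) (p : R).

Let mu := @lebesgue_rV R n.

(* L^p(Omega); values outside Omega are irrelevant. *)
Definition Lp Omega p u : Prop := (u \_ Omega)%function \in Lfun mu p%:E.

Definition cvg_Lp Omega p (u_ : nat -> 'rV[R]_n -> R) u : Prop :=
  'N[mu]_(p%:E)[EFin \o ((u_ k \- u)%R \_ Omega)%function]%E @[k --> \oo]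
    --> 0%E.

Definition weak_gradient Omega u Du : Prop :=
  forall (phi : 'rV[R]_n -> R) (i : 'I_n), test_function Omega phi ->
    \int[mu]_(x in Omega) (u x * partial i phi x) =
    - \int[mu]_(x in Omega) (Du x ord0 i * phi x).

(* u belongs to W^{1,p}(Omega), with weak gradient Du. *)
Definition sobolev Omega p u Du : Prop :=
  [/\ Lp Omega p u, forall i, Lp Omega p (fun x => Du x ord0 i)
    & weak_gradient Omega u Du].

(* u belongs to W_0^{1,p}(Omega), the closure of C_c^infty(Omega) in
   W^{1,p}(Omega), with weak gradient Du. *)
Definition sobolev0 Omega p u Du : Prop :=
  sobolev Omega p u Du /\
  exists phi : nat -> 'rV[R]_n -> R,
    [/\ forall k, test_function Omega (phi k), cvg_Lp Omega p phi u
      & forall i, cvg_Lp Omega p (fun k => partial i (phi k))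
                    (fun x => Du x ord0 i)].

(* u <= M on the boundary of Omega in the Sobolev sense: the positive part of
   u - M belongs to W_0^{1,p}(Omega). *)
Definition boundary_le Omega p u (M : R) : Prop :=
  exists D, sobolev0 Omega p (fun x => Num.max (u x - M) 0) D.

End sobolev.

Section anisotropic_laplacian.
Context (R : realType) (N : nat) (F : 'rV[R]_N -> R).

Record anisotropic_norm : Prop := {
  F_ge0 : forall xi, 0 <= F xi ;
  F_convex : convex_function (setT : set (convex_lmodType 'rV[R]_N)) F ;
  F_C2 : Ck 2 [set xi | xi != 0] F ;
  F_homo : forall t xi, F (t *: xi) = `|t| * F xi ;
  F_gt0 : forall xi, xi != 0 -> 0 < F xi ;
  F_posdef : forall xi, xi != 0 -> posdefmx (hess (fun eta => F eta ^+ 2) xi)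
}.

(* The vector field F^{N-1} F_xi; F is not differentiable at 0, where the field
   is 0 by convention. *)
Definition QN_flux (xi : 'rV[R]_N) : 'rV[R]_N :=
  if xi == 0 then 0 else F xi ^+ N.-1 *: grad F xi.

(* u in W^{1,N}(Omega) satisfies - Q_N u <= 0 weakly in Omega. *)
Definition QN_subsolution (Omega : set 'rV[R]_N) (u : 'rV[R]_N -> R) : Prop :=
  exists Du, sobolev Omega N%:R u Du /\
    forall phi Dphi, sobolev0 Omega N%:R phi Dphi ->
      {ae @lebesgue_rV R N, forall x, Omega x -> 0 <= phi x} ->
      \int[@lebesgue_rV R N]_(x in Omega) dotp (QN_flux (Du x)) (Dphi x) <= 0.

End anisotropic_laplacian.

(* Main.v *)
Require Import Defs.
From mathcomp Require Import all_boot all_order all_algebra.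
From mathcomp Require Import all_classical all_reals all_analysis.
From mathcomp Require Import measurable_realfun ring lra.

(** Let w = (u - M)^+ with weak gradient D, Du the weak gradient of u, and
    v = u - M - w <= 0. As w is a limit of test functions, products of w with
    functions having weak gradients may be differentiated by the Leibniz rule
    without mollification: v w = 0 gives v D + w (Du - D) = 0, hence Du = D
    where w > 0; testing the weak gradient of w against psi / (1 + (k w)^2) and
    letting k tend to infinity gives D = 0 where w = 0. With w itself as test
    function in the subsolution inequality and Euler's identity
    <F_xi(xi), xi> = F(xi), we get that the integral of F(D)^N is nonpositive,
    so D = 0. Finally the integral of the derivative of x_0 w^2 vanishes, so
    the integral of w^2 is -2 times that of x_0 w D_0, which is 0. *)

Set Implicit Arguments.
Unset Strict Implicit.
Unset Printing Implicit Defensive.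

Import Order.TTheory GRing.Theory Num.Theory.
Import numFieldNormedType.Exports.

Local Open Scope classical_set_scope.
Local Open Scope ring_scope.

(** * Smooth functions *)

(** [boundary_le] only asserts that some weak gradient [D] of w exists, so at the outset nothing
    links [D] to [Du]. The link is needed on both regions: where w > 0 it turns the flux of [Du]
    into the flux of [D], and where w = 0 it removes the pairing of that flux with [D], which would
    have no sign. Limits of test functions are taken in L^2. Since N >= 2 and Omega has finite
    measure, convergence in L^N gives convergence in L^2, where products of two functions are
    integrable and a weighted Young inequality replaces Hoelder. The exponent N itself returns for
    the integrability of F(D)^N. Identities linear in phi and its derivatives pass to w by
    continuity. The one for the zero set is not linear in phi and needs a pointwise estimate at
    fixed k before k grows. The cutoff 1 / (1 + s^2) suits this: its derivative is a polynomial in s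
    and the cutoff itself, and s^2 / (1 + s^2) = 1 - 1 / (1 + s^2) keeps the terms created by
    differentiation bounded independently of k. *)

Lemma is_derive_line (R : realType) (V W : normedModType R) (f : V -> W)
    (a v : V) (d : W) :
  is_derive a v f d <-> is_derive (0 : R) 1 (fun t => f (t *: v + a)) d.
Proof.
have E : (fun h : R => h^-1 *: ((f \o shift a) (h *: v) - f a)) =
    (fun h : R => h^-1 *:
      (((fun t => f (t *: v + a)) \o shift 0) (h *: (1 : R)) -
       (fun t => f (t *: v + a)) 0)).
  by apply/funext => h /=; rewrite addr0 scale0r add0r [h%:A]mulr1.
have E2 : 'D_v f a = 'D_1 (fun t : R => f (t *: v + a)) (0 : R).
  by rewrite /derive E.
by split=> -[df <-]; split; rewrite ?E2//; move: df; rewrite /derivable E.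
Qed.

(** Only a directional derivative of [f] is assumed, so the one-variable chain rule is applied along
    the line through [a] with direction [v]. *)
Lemma is_derive_comp_dir (R : realType) (V : normedModType R) (g : R -> R)
    (f : V -> R) (a v : V) (df dg : R) :
  is_derive a v f df -> is_derive (f a) 1 g dg ->
  is_derive a v (fun x => g (f x)) (dg * df).
Proof.
move=> /is_derive_line hf hg; apply/is_derive_line.
apply: (@is_derive1_comp _ g (fun t : R => f (t *: v + a)) 0 dg df) => //.
by rewrite scale0r add0r.
Qed.

Section smooth.
Context (R : realType) (n : nat).
Implicit Types (f g : 'rV[R]_n -> R).

Definition smooth f : Prop := forall k, Ck k setT f.

Lemma Ck_continuous k f : Ck k setT f -> continuous f.
Proof. by case: k => [|k] [cf _] x; exact: cf. Qed.

(** The candidates [df] are explicit formulas, so that an induction on [k] can run on them instead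
    of on the limits that define [partial]. *)
Lemma CkS k f (df : 'I_n -> 'rV[R]_n -> R) : continuous f ->
  (forall i x, is_derive x (delta_mx ord0 i) f (df i x)) ->
  (forall i, Ck k setT (df i)) -> Ck k.+1 setT f.
Proof.
move=> cf hdf Cdf; split=> [x _|i]; first exact: cf.
split=> [x _|]; first by case: (hdf i x).
rewrite (_ : partial i f = df i)//; apply/funext => x.
by rewrite /partial; case: (hdf i x).
Qed.

Lemma CkS_inv k f : Ck k.+1 setT f ->
  [/\ continuous f,
    forall i x, is_derive x (delta_mx ord0 i) f (partial i f x) &
    forall i, Ck k setT (partial i f)].
Proof.
case=> cf df; split; first by move=> x; exact: cf.
  by move=> i x; apply: derivableP; case: (df i) => + _; exact.
by move=> i; case: (df i).
Qed.

Lemma CkW k f : Ck k.+1 setT f -> Ck k setT f.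
Proof.
elim: k f => [|k IH] f Cf.
  by split => // x _; exact: (Ck_continuous Cf).
have [cf df Cdf] := CkS_inv Cf.
by apply: (CkS cf df) => i; apply: IH.
Qed.

Lemma Ck_cst k (c : R) : Ck k setT (fun _ : 'rV[R]_n => c).
Proof.
elim: k c => [|k IH] c; first by split => // x _; exact: cst_continuous.
apply: (@CkS _ _ (fun _ _ => 0)) => // x.
exact: cst_continuous.
Qed.

Lemma CkD k f g : Ck k setT f -> Ck k setT g -> Ck k setT (fun x => f x + g x).
Proof.
elim: k f g => [|k IH] f g Cf Cg.
  by split => // x _; apply: continuousD; [exact: (Ck_continuous Cf)|
    exact: (Ck_continuous Cg)].
have [cf df Cdf] := CkS_inv Cf; have [cg dg Cdg] := CkS_inv Cg.
apply: (@CkS _ _ (fun i x => partial i f x + partial i g x)).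
- by move=> x; apply: continuousD; [exact: cf|exact: cg].
- by move=> i; apply: IH; [exact: Cdf|exact: Cdg].
Qed.

Lemma CkM k f g : Ck k setT f -> Ck k setT g -> Ck k setT (fun x => f x * g x).
Proof.
elim: k f g => [|k IH] f g Cf Cg.
  by split => // x _; apply: continuousM; [exact: (Ck_continuous Cf)|
    exact: (Ck_continuous Cg)].
have [cf df Cdf] := CkS_inv Cf; have [cg dg Cdg] := CkS_inv Cg.
apply: (@CkS _ _ (fun i x => f x * partial i g x + g x * partial i f x)).
- by move=> x; apply: continuousM; [exact: cf|exact: cg].
- by move=> i; apply: CkD; apply: IH => //; exact: CkW.
Qed.

Lemma CkZ k (c : R) f : Ck k setT f -> Ck k setT (fun x => c * f x).
Proof. by apply: CkM; exact: Ck_cst. Qed.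

Lemma is_derive_coord (i j : 'I_n) (x : 'rV[R]_n) :
  is_derive x (delta_mx ord0 i) (fun y : 'rV[R]_n => y ord0 j : R)
    ((i == j)%:R).
Proof.
apply/is_derive_line; rewrite [X in is_derive _ _ X _](_ : _ =
    (fun t : R => t * (i == j)%:R + x ord0 j)); last first.
  by apply/funext => t; rewrite !mxE eqxx/= eq_sym.
by apply: is_derive_eq; rewrite addr0 scaler0 add0r [_ *: _]mulr1.
Qed.

Lemma Ck_coord k (j : 'I_n) : Ck k setT (fun y : 'rV[R]_n => y ord0 j : R).
Proof.
case: k => [|k]; first by split => // x _; exact: coord_continuous.
apply: (CkS _ (fun i x => is_derive_coord i j x)) => [x|i].
  exact: coord_continuous.
exact: Ck_cst.
Qed.

Lemma is_derive_ratio f (df : R) (x v : 'rV[R]_n) : is_derive x v f df ->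
  is_derive x v (fun y => (1 + f y ^+ 2)^-1)
    (- 2 * (f x * df) * ((1 + f x ^+ 2)^-1 * (1 + f x ^+ 2)^-1)).
Proof.
move=> hx; have nz : 1 + f x ^+ 2 != 0.
  by rewrite gt_eqF// ltr_pwDl// sqr_ge0.
have [dq1 dq2] : is_derive x v (fun x => 1 + f x ^+ 2) (2 * f x * df).
  have := is_deriveD (is_derive_cst (1 : R) x v) (is_deriveM hx hx).
  rewrite (_ : 0 + _ = 2 * f x * df)//.
  by rewrite /GRing.scale/=; ring.
have -> : - 2 * (f x * df) * ((1 + f x ^+ 2)^-1 / (1 + f x ^+ 2))
    = - (1 + f x ^+ 2) ^- 2 *: (2 * f x * df).
  by rewrite /GRing.scale/= -exprVn; ring.
rewrite -dq2; apply: DeriveDef; first exact: derivableV.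
exact: (@deriveV _ _ (fun x => 1 + f x ^+ 2) x _ nz dq1).
Qed.

(** By [is_derive_ratio] each partial derivative is a polynomial in [f], its partial derivative and
    the same ratio, so the induction closes with [f] fixed. *)
Lemma Ck_ratio k f : smooth f ->
  Ck k setT (fun x => (1 + f x ^+ 2)^-1).
Proof.
move=> sf; have nz x : 1 + f x ^+ 2 != 0.
  by rewrite gt_eqF// ltr_pwDl// sqr_ge0.
have cf := Ck_continuous (sf 0%N).
have cr : continuous (fun x => (1 + f x ^+ 2)^-1).
  move=> x.
  have c1 : (1 + f y ^+ 2) @[y --> x] --> 1 + f x ^+ 2.
    under eq_fun do rewrite expr2.
    by rewrite expr2; apply: (cvgD (@cvg_cst _ _ _ _ _) (cvgM (cf x) (cf x))).
  exact: (cvgV (nz x) c1).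
elim: k => [|k IH]; first by split => // x _; exact: cr.
have [_ df _] := CkS_inv (sf 1%N).
apply: (CkS cr (fun i x => is_derive_ratio (df i x))) => i.
apply: CkM; last exact: CkM.
by apply: CkZ; apply: CkM => //; have [_ _] := CkS_inv (sf k.+1); exact.
Qed.

End smooth.

(** * Smooth bump functions on boxes *)

Section flat.
Context (R : realType).

(** For j = 0 this is the classical exp(-1/x) extended by 0. The index makes the family stable under
    differentiation: the derivative of index j is a combination of the indices j + 1 and j + 2. *)
Definition flat (j : nat) (x : R) : R :=
  if 0 < x then x^-1 ^+ j * expR (- x^-1) else 0.

Lemma flat_ge0 j x : 0 <= flat j x.
Proof.
rewrite /flat; case: ifPn => // x0.
by rewrite mulr_ge0 ?expR_ge0// exprn_ge0// invr_ge0 ltW.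
Qed.

Lemma flat_gt0 j x : (0 < flat j x) = (0 < x).
Proof.
rewrite /flat; case: ifPn; rewrite ?ltxx// => x0.
by rewrite mulr_gt0 ?expR_gt0// exprn_gt0// invr_gt0.
Qed.

(** With y = 1/x, one term of the exponential series gives y^(j+1) <= (j+1)! e^y. The bound is
    linear in x, which controls the behaviour at the origin. *)
Lemma flat_le j x : flat j x <= j.+1`!%:R * `|x|.
Proof.
rewrite /flat; case: ifPn => [x0|_]; last by rewrite mulr_ge0.
have y0 : 0 < x^-1 by rewrite invr_gt0.
rewrite gtr0_norm// expRN ler_pdivrMr ?expR_gt0// mulrAC -ler_pdivrMr//.
rewrite -exprSr mulrC -ler_pdivrMr ?ltr0n ?fact_gt0//.
by apply: le_trans (expR_ge1Dxn j (ltW y0)); rewrite lerDr.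
Qed.

Lemma flatS j x : flat j.+1 x = x^-1 * flat j x.
Proof. by rewrite /flat; case: ifPn => _; rewrite ?mulr0// exprS mulrA. Qed.

Lemma is_derive_flat j (x : R) :
  is_derive x 1 (flat j) (- j%:R * flat j.+1 x + flat j.+2 x).
Proof.
have [x0|x0|->] := ltgtP x 0.
- have -> : - j%:R * flat j.+1 x + flat j.+2 x = 0.
    by rewrite /flat (le_gtF (ltW x0)) mulr0 addr0.
  apply: (@near_eq_is_derive _ _ _ (cst 0)) => //.
  near=> y; rewrite /flat ifF//; apply/negbTE; rewrite -leNgt ltW//.
  by near: y; exact: lt_nbhsl.
- apply: (@near_eq_is_derive R R R (fun y : R => y^-1 ^+ j * expR (- y^-1))) => //.
    near=> y; rewrite /flat ifT//.
    by near: y; exact: lt_nbhsr.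
  have dV : is_derive x 1 (fun y : R => y^-1) (- x ^- 2).
    have := @is_deriveV R (fun y : R => y) x 1 1.
    by rewrite [_ *: _]mulr1; apply; rewrite gt_eqF.
  have dE : is_derive x 1 (fun y : R => expR (- y^-1)) (x ^- 2 * expR (- x^-1)).
    have -> : x ^- 2 * expR (- x^-1) = expR (- x^-1) * - (- x ^- 2).
      by rewrite opprK mulrC.
    have dN : is_derive x 1 (fun y : R => - y^-1) (- (- x ^- 2)).
      exact: (@is_deriveN _ _ _ (fun y : R => y^-1)).
    exact: (is_derive_comp_dir dN (is_derive_expR _)).
  have dX : is_derive x 1 (fun y : R => y^-1 ^+ j) (- (j%:R * x^-1 ^+ j.+1)).
    case: (j) => [|k]; first by rewrite mul0r oppr0; exact: is_derive_cst.
    have dp : is_derive x^-1 1 (@GRing.exp R ^~ k.+1) (k.+1%:R * x^-1 ^+ k).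
      apply: DeriveDef; first exact: exprn_derivable.
      by rewrite exp_derive [_ *: 1]mulr1.
    have := is_derive_comp_dir dV dp.
    rewrite (_ : _ * _ = - (k.+1%:R * x^-1 ^+ k.+2))//.
    by rewrite mulrN -exprVn !exprS expr0; congr (- _); ring.
  have := @is_deriveM _ _ _ _ x 1 _ _ dX dE.
  rewrite (_ : _ + _ = - j%:R * flat j.+1 x + flat j.+2 x)//.
  by rewrite /flat x0 /GRing.scale/= -exprVn !exprS expr0; ring.
have z k : flat k 0 = 0 by rewrite /flat ltxx.
rewrite !z mulr0 addr0.
(* At the origin the difference quotient of [flat j] is [flat j.+1], which tends to 0 by
   [flat_le]. *)
have C : h^-1 *: ((flat j \o shift 0) (h *: 1) - flat j 0) @[h --> (0:R)^'] --> (0:R).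
  apply/cvgrPdist_lt => e e0; near=> h.
  rewrite sub0r normrN /= addr0 z subr0 [_ *: 1]mulr1.
  rewrite /GRing.scale/= -flatS ger0_norm ?flat_ge0//.
  apply: (le_lt_trans (flat_le _ _)).
  rewrite mulrC -ltr_pdivlMr ?ltr0n ?fact_gt0//.
  by near: h; apply: dnbhs0_lt; rewrite divr_gt0// ltr0n fact_gt0.
apply: DeriveDef; first by apply/cvg_ex; exists 0.
exact/cvg_lim.
Unshelve. all: by end_near. Qed.

Lemma continuous_flat j : continuous (flat j).
Proof.
move=> x; apply/differentiable_continuous/derivable1_diffP.
by have [] := is_derive_flat j x.
Qed.

Lemma Ck_flat n k j (h : 'rV[R]_n -> R) : smooth h ->
  Ck k setT (fun x => flat j (h x)).
Proof.
move=> sh; elim: k j => [|k IH] j.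
  split => // x _; apply: continuous_comp; last exact: continuous_flat.
  exact: (Ck_continuous (sh 0%N)).
have [ch dh _] := CkS_inv (sh 1%N).
apply: (@CkS _ _ _ _ (fun i x =>
    (- j%:R * flat j.+1 (h x) + flat j.+2 (h x)) * partial i h x)).
- by move=> x; apply: continuous_comp; [exact: ch|exact: continuous_flat].
- move=> i x; have h1 := dh i x; have h2 := is_derive_flat j (h x).
  exact: is_derive_comp_dir h1 h2.
- move=> i; apply: CkM; last by have [_ _] := CkS_inv (sh k.+1); exact.
  by apply: CkD; [apply: CkZ|]; exact: IH.
Qed.

(** The nonzero set is exactly an open box, so products of bumps have boxes as nonzero sets too:
    this matches the pi-system of boxes used in the fundamental lemma. *)
Definition box_bump n (a b x : 'rV[R]_n) : R :=
  \prod_i (flat 0 (x ord0 i - a ord0 i) * flat 0 (b ord0 i - x ord0 i)).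

Lemma smooth_box_bump n (a b : 'rV[R]_n) : smooth (box_bump a b).
Proof.
move=> k; rewrite (_ : box_bump a b = \big[(fun f g x => f x * g x)/(fun=> 1)]_i
    (fun x => flat 0 (x ord0 i - a ord0 i) * flat 0 (b ord0 i - x ord0 i))).
  elim/big_ind : _ => [|f g Cf Cg|i _]; [exact: Ck_cst|exact: CkM|].
  apply: CkM; apply: Ck_flat => l.
    by apply: CkD; [exact: Ck_coord|exact: Ck_cst].
  apply: CkD; first exact: Ck_cst.
  rewrite [X in Ck _ _ X](_ : _ = (fun x : 'rV[R]_n => -1 * x ord0 i)).
    by apply: CkZ; exact: Ck_coord.
  by apply/funext => x; rewrite mulN1r.
apply/funext => x; rewrite /box_bump.
by elim/big_rec2 : _ => // i y z _ ->.
Qed.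

Lemma box_bump_neq0 n (a b x : 'rV[R]_n) :
  (box_bump a b x != 0) <-> forall i, a ord0 i < x ord0 i < b ord0 i.
Proof.
have p y : (flat 0 y != 0) = (0 < y) by rewrite -(flat_gt0 0) lt0r flat_ge0 andbT.
have pos i : (flat 0 (x ord0 i - a ord0 i) * flat 0 (b ord0 i - x ord0 i) != 0) =
    (a ord0 i < x ord0 i < b ord0 i).
  by rewrite mulf_eq0 negb_or !p !subr_gt0.
split=> [/prodf_neq0 h i|h]; first by rewrite -pos h.
by apply/prodf_neq0 => i _; rewrite pos.
Qed.

End flat.

(** * Boxes, open sets and test functions *)

Section boxes.
Context (R : realType) (n : nat).
Implicit Types (a b x : 'rV[R]_n) (U Omega : set 'rV[R]_n).

Local Notation mu := (@lebesgue_rV R n).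

Definition obox a b := [set x : 'rV[R]_n | forall i, a ord0 i < x ord0 i < b ord0 i].
Definition cbox a b := [set x : 'rV[R]_n | forall i, a ord0 i <= x ord0 i <= b ord0 i].

Lemma sub_obox_cbox a b : obox a b `<=` cbox a b.
Proof. by move=> x h i; have /andP[/ltW-> /ltW->] := h i. Qed.

Lemma measurable_box (A : 'I_n -> set R) : (forall i, measurable (A i)) ->
  measurable [set x : 'rV[R]_n | forall i, A i (x ord0 i)].
Proof.
move=> mA; rewrite (_ : mkset _ =
    \bigcap_(i in [set: 'I_n]) ((fun x : 'rV[R]_n => x ord0 i : R) @^-1` A i)).
  apply: fin_bigcap_measurable => // i _; rewrite -[X in measurable X]setTI.
  exact: measurable_coord.
by apply/seteqP; split => x /= h i; [move=> _|]; exact: h.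
Qed.

Lemma oboxE a b : obox a b =
  [set x : 'rV[R]_n | forall i, `]a ord0 i, b ord0 i[%classic (x ord0 i)].
Proof. by apply/seteqP; split => x /= h i; have := h i; rewrite /= in_itv. Qed.

Lemma cboxE a b : cbox a b =
  [set x : 'rV[R]_n | forall i, `[a ord0 i, b ord0 i]%classic (x ord0 i)].
Proof. by apply/seteqP; split => x /= h i; have := h i; rewrite /= in_itv. Qed.

Lemma measurable_obox a b : measurable (obox a b).
Proof.
rewrite oboxE.
by apply: (@measurable_box (fun i => `]a ord0 i, b ord0 i[%classic)) => i.
Qed.

Lemma measurable_cbox a b : measurable (cbox a b).
Proof.
rewrite cboxE.
by apply: (@measurable_box (fun i => `[a ord0 i, b ord0 i]%classic)) => i.
Qed.

Lemma compact_cbox a b : compact (cbox a b).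
Proof.
rewrite cboxE.
by apply: (@rV_compact R n (fun i => `[a ord0 i, b ord0 i]%classic)) => i;
  exact: segment_compact.
Qed.

Lemma cbox_lty a b : (mu (cbox a b) < +oo)%E.
Proof.
rewrite cboxE (lebesgue_rV_box (A := fun i => `[a ord0 i, b ord0 i]%classic)).
  rewrite ltey_eq; apply/orP; left; apply: prode_fin_num => i _.
  rewrite lebesgue_measure_itv/=; case: ifP => // _.
by move=> i; exact: measurable_itv.
Qed.

(** Cubes with rational centre and half-side 1 / (k + 1) form a countable family, fit for countable
    unions and for almost-everywhere statements. *)
Definition rat_lo (q : 'rV[rat]_n * nat) : 'rV[R]_n :=
  \row_i (ratr (q.1 ord0 i) - q.2.+1%:R^-1).
Definition rat_hi (q : 'rV[rat]_n * nat) : 'rV[R]_n :=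
  \row_i (ratr (q.1 ord0 i) + q.2.+1%:R^-1).

(** The half-side is below e / 2 and x is that close to the centre, so the closed cube stays in the
    ball of radius e around x. The closed cube is placed in [U] because it has to carry the compact
    support of a bump. *)
Lemma open_rat_box U x : open U -> U x ->
  exists q, obox (rat_lo q) (rat_hi q) x /\ cbox (rat_lo q) (rat_hi q) `<=` U.
Proof.
move=> oU Ux; have /nbhs_ballP[e /= e0 eU] := open_nbhs_nbhs (conj oU Ux).
have [k] : exists k, 0 + k.+1%:R^-1 < e / 2 by apply: ltr_add_invr; rewrite divr_gt0.
rewrite add0r => ke; have k0 : (0 : R) < k.+1%:R^-1 by rewrite invr_gt0.
have [d dE] : {d : R | d = k.+1%:R^-1} by exists k.+1%:R^-1.
rewrite -dE in ke k0.
have /choice[q hq] : forall i : 'I_n, exists q : rat,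
    x ord0 i - d < ratr q < x ord0 i + d.
  move=> i; have lt : x ord0 i - d < x ord0 i + d by lra.
  have [q hq] := rat_in_itvoo lt.
  by exists q; move: hq; rewrite in_itv.
exists (\row_i q i, k); split=> [i|y hy].
  by rewrite !mxE/= -dE; have /andP[h1 h2] := hq i; apply/andP; split; lra.
apply: eU; split => // i0 i; rewrite (ord1 i0) /ball/=.
have := hy i; rewrite !mxE/= -dE => /andP[h1 h2].
have /andP[h3 h4] := hq i.
by rewrite ltr_norml; apply/andP; split; lra.
Qed.

Lemma countable_rat_boxes : countable [set: 'rV[rat]_n * nat].
Proof. exact: countableP. Qed.

(** The sigma-algebra is generated by the coordinates and not by the topology, so an open set is
    first written as a countable union of boxes. *)
Lemma open_measurable_rV U : open U -> measurable U.
Proof.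
move=> oU; rewrite (_ : U = \bigcup_(q : 'rV[rat]_n * nat)
    (if `[< cbox (rat_lo q) (rat_hi q) `<=` U >] then obox (rat_lo q) (rat_hi q)
     else set0)).
  apply: countable_bigcupT_measurable; first exact: countable_rat_boxes.
  by move=> q; case: ifP => // _; exact: measurable_obox.
apply/seteqP; split => [x Ux|x [q _]]; last first.
  by case: ifPn => // /asboolP qU /sub_obox_cbox/qU.
have [q [qx qU]] := open_rat_box oU Ux.
by exists q => //; rewrite ifT//; apply/asboolP.
Qed.

Lemma open_continuous_measurable_rV U (f : 'rV[R]_n -> R) : open U ->
  (forall x, U x -> {for x, continuous f}) -> measurable_fun U f.
Proof.
move=> oU cf; apply: (measurability _ (RGenOpens.measurableE R)).
move=> _ [_ [a [b ->] <-]]; apply: open_measurable_rV.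
rewrite openE => x [Ux fx]; apply: filterI; first exact: open_nbhs_nbhs.
by apply: (cf x Ux); apply: open_nbhs_nbhs; split => //; exact: interval_open.
Qed.

Lemma continuous_measurable_rV (f : 'rV[R]_n -> R) : continuous f ->
  measurable_fun setT f.
Proof. by move=> cf; apply: open_continuous_measurable_rV => [|x _]; [exact: (@openT 'rV[R]_n)|exact: cf]. Qed.

Lemma bounded_set_coord Omega : bounded_set Omega ->
  exists r : R, 0 < r /\ forall x i, Omega x -> `|x ord0 i| <= r.
Proof.
case=> M [_ hM]; exists (`|M| + 1); split; first by rewrite ltr_wpDl.
move=> x i Ox; apply: le_trans (hM (`|M| + 1) _ x Ox).
  rewrite [leRHS]mx_normrE; exact: (le_bigmax _ (fun ij => `|x ij.1 ij.2|) (ord0, i)).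
by rewrite (le_lt_trans (ler_norm M))// ltrDl.
Qed.

Lemma bounded_lty Omega : measurable Omega -> bounded_set Omega ->
  (mu Omega < +oo)%E.
Proof.
move=> mO /bounded_set_coord[r [r0 hr]].
apply: le_lt_trans (cbox_lty (const_mx (- r)) (const_mx r)).
apply: le_measure; rewrite ?inE//; first exact: measurable_cbox.
by move=> x Ox i; rewrite !mxE -ler_norml hr.
Qed.

End boxes.

Section test.
Context (R : realType) (n : nat) (Omega : set 'rV[R]_n).
Implicit Types (f g : 'rV[R]_n -> R).

Lemma test_smooth f : test_function Omega f -> smooth f.
Proof. by case. Qed.

Lemma test_smul f g : smooth f -> test_function Omega g ->
  test_function Omega (fun x => f x * g x).
Proof.
move=> sf [sg [K [cK KO gK]]]; split; first by move=> k; exact: CkM.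
by exists K; split => // x Kx; rewrite gK// mulr0.
Qed.

Lemma test_bounded f : test_function Omega f ->
  exists C, 0 <= C /\ forall x, `|f x| <= C.
Proof.
move=> [sf [K [cK _ fK]]].
have /compact_bounded[M [_ hM]] : compact (f @` K).
  apply: continuous_compact => //.
  by apply: continuous_subspaceT; exact: (Ck_continuous (sf 0%N)).
exists (`|M| + 1); split; first by rewrite addr_ge0.
move=> x; have [Kx|Kx] := pselect (K x); last by rewrite fK// normr0 addr_ge0.
apply: hM; first by rewrite (le_lt_trans (ler_norm M))// ltrDl.
by exists x.
Qed.

Lemma test_partial f i : test_function Omega f ->
  test_function Omega (partial i f).
Proof.
move=> [sf [K [cK KO fK]]]; split.
  by move=> k; have [_ _] := CkS_inv (sf k.+1); exact.
exists K; split => // x Kx; rewrite /partial.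
have oK : open (~` K) by apply: closed_openC; apply: compact_closed.
rewrite (@near_eq_derive _ _ _ f (cst 0)) ?derive_cst//.
by near=> y; apply: fK; near: y; exact: open_nbhs_nbhs.
Unshelve. all: by end_near. Qed.

Lemma test_bump a b : cbox a b `<=` Omega -> test_function Omega (box_bump a b).
Proof.
move=> abO; split; first exact: smooth_box_bump.
exists (cbox a b); split => //; first exact: compact_cbox.
move=> x; apply: contra_notP => /eqP/box_bump_neq0 h.
exact: sub_obox_cbox.
Qed.

Lemma partialM f g i x : smooth f -> smooth g ->
  partial i (fun x => f x * g x) x = f x * partial i g x + g x * partial i f x.
Proof.
move=> sf sg; have [_ df _] := CkS_inv (sf 1%N); have [_ dg _] := CkS_inv (sg 1%N).
have hf := df i x; have hg := dg i x.
by have [_] := is_deriveM hf hg.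
Qed.

End test.

(** * The fundamental lemma of the calculus of variations *)

Section integrability.
Context d (T : measurableType d) (R : realType)
  (mu : {measure set T -> \bar R}) (D : set T) (mD : measurable D).
Implicit Types f g : T -> R.

Definition itg f := mu.-integrable D (EFin \o f).

Lemma itg_measurable f : itg f -> measurable_fun D f.
Proof. by move=> /measurable_int/measurable_EFinP. Qed.

Lemma itg_le f g : measurable_fun D f -> (forall x, D x -> `|f x| <= g x) ->
  itg g -> itg f.
Proof.
move=> mf fg; apply: le_integrable => //; first exact/measurable_EFinP.
move=> x Dx /=; rewrite lee_fin; apply: le_trans (fg x Dx) _; exact: ler_norm.
Qed.

Lemma itgD f g : itg f -> itg g -> itg (fun x => f x + g x).
Proof. by move=> If Ig; exact: (integrableD mD If Ig). Qed.

Lemma itgZ (c : R) f : itg f -> itg (fun x => c * f x).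
Proof. by move=> If; exact: (integrableZl mD c If). Qed.

Lemma itgN f : itg f -> itg (fun x => - f x).
Proof. by move=> If; exact: (integrableN If). Qed.

Lemma itgB f g : itg f -> itg g -> itg (fun x => f x - g x).
Proof. by move=> If /itgN; exact: itgD. Qed.

Lemma itg_norm f : itg f -> itg (fun x => `|f x|).
Proof. exact: integrable_norm. Qed.

Lemma itg_mul_bounded C f g : itg f -> measurable_fun D g ->
  (forall x, D x -> `|g x| <= C) -> itg (fun x => f x * g x).
Proof.
move=> If mg gC; apply: (@itg_le _ (fun x => C * `|f x|)).
- by apply: measurable_funM => //; exact: itg_measurable.
- by move=> x Dx; rewrite normrM mulrC ler_wpM2r// gC.
- by apply: itgZ; exact: itg_norm.
Qed.

Lemma EFin_Rintegral f : itg f ->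
  (\int[mu]_(x in D) f x)%:E = (\int[mu]_(x in D) (f x)%:E)%E.
Proof. by move=> If; rewrite fineK//; exact: integrable_fin_num. Qed.

End integrability.

(** A smooth approximation of the indicator of {0}. Composed with a test function or with w, it
    yields the indicators of a nonzero set or of a zero set as dominated limits. *)
Lemma ratio_cvg (R : realType) (c : R) :
  (1 + (k%:R * c) ^+ 2)^-1 @[k --> \oo] --> ((c == 0)%:R : R).
Proof.
have [->|c0] := eqVneq c 0.
  rewrite (_ : (fun k => _) = cst 1); first exact: cvg_cst.
  by apply/funext => k; rewrite mulr0 expr0n/= addr0 invr1.
apply/cvgrPdist_lt => e e0; near=> k.
have c2 : 0 < c ^+ 2 by rewrite exprn_even_gt0.
have k1 : 1 < k%:R :> R by near: k; exact: nbhs_infty_gtr.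
have k2 : e^-1 / c ^+ 2 < k%:R by near: k; exact: nbhs_infty_gtr.
have p : 0 < 1 + (k%:R * c) ^+ 2 by rewrite ltr_pwDl// sqr_ge0.
rewrite sub0r normrN ger0_norm ?invr_ge0 ?(ltW p)//.
rewrite invf_plt ?posrE//.
rewrite ltr_pdivrMr// in k2; apply: (lt_le_trans k2).
rewrite exprMn; apply: le_trans (_ : k%:R ^+ 2 * c ^+ 2 <= _); last by rewrite lerDr.
by rewrite ler_pM2r// expr2 ler_peMr// ltW// (lt_trans ltr01).
Unshelve. all: by end_near. Qed.

Section fundamental.
Context (R : realType) (n : nat) (Omega : set 'rV[R]_n).
Hypothesis oO : open Omega.
Local Notation mu := (@lebesgue_rV R n).

Let mO : measurable Omega. Proof. exact: open_measurable_rV. Qed.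

Lemma test_measurable (psi : 'rV[R]_n -> R) D : measurable D ->
  test_function Omega psi -> measurable_fun D psi.
Proof.
move=> mD tp; apply: (@measurable_funTS _ _ _ _ D psi).
apply: continuous_measurable_rV.
exact: (Ck_continuous (test_smooth tp 0%N)).
Qed.

(** Dominated convergence lets the indicator of the set where [psi] is nonzero play the role of a
    test function. *)
Lemma test_support_integral0 (g psi : 'rV[R]_n -> R) :
  itg mu Omega g ->
  (forall psi, test_function Omega psi ->
    \int[mu]_(x in Omega) (g x * psi x) = 0) ->
  test_function Omega psi ->
  (\int[mu]_(x in [set x | (psi x != 0)%R]) (g x)%:E = 0)%E.
Proof.
move=> Ig H tp; have sp := test_smooth tp.
(* This is (k psi)^2 / (1 + (k psi)^2). The trailing factor [psi] provides the compact support, the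
   values are bounded by 1, and the limit is the indicator of psi != 0. *)
pose eta (k : nat) x := k%:R * k%:R * psi x * (1 + (k%:R * psi x) ^+ 2)^-1 * psi x.
have teta k : test_function Omega (eta k).
  apply: test_smul => // l.
  by apply: CkM; [exact: CkZ|apply: Ck_ratio => m; exact: CkZ].
have etaE k x : eta k x = 1 - (1 + (k%:R * psi x) ^+ 2)^-1.
  have p : 1 + (k%:R * psi x) ^+ 2 != 0 by rewrite gt_eqF// ltr_pwDl// sqr_ge0.
  by rewrite /eta; field.
have eta_bnd k x : `|eta k x| <= 1.
  rewrite etaE; have p : 1 <= 1 + (k%:R * psi x) ^+ 2 by rewrite lerDl sqr_ge0.
  have q1 : (1 + (k%:R * psi x) ^+ 2)^-1 <= 1 by rewrite invf_le1// (lt_le_trans ltr01).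
  have q0 : 0 <= (1 + (k%:R * psi x) ^+ 2)^-1 by rewrite invr_ge0 (le_trans ler01).
  by rewrite ler_norml; apply/andP; split; lra.
have Ieta k : itg mu Omega (fun x => g x * eta k x).
  by apply: (itg_mul_bounded mO Ig (test_measurable mO (teta k)) (fun x _ => eta_bnd k x)).
pose S := [set x | psi x != 0].
have SO : S `<=` Omega.
  move=> x /eqP px; have [_ [K [_ KO pK]]] := tp.
  by apply: KO; apply: contrapT => /pK.
have mS : measurable S.
  have := test_measurable measurableT tp measurableT (measurableC (measurable_set1 (0 : R))).
  rewrite setTI (_ : _ @^-1` _ = S)//.
  by apply/seteqP; split => x /= /eqP.
pose f (x : 'rV[R]_n) := g x * (psi x != 0)%:R.
have mf : measurable_fun Omega f.
  apply: measurable_funM; first exact: itg_measurable Ig.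
  rewrite (_ : (fun x => _) = \1_S); first exact: measurable_indic.
  by apply/funext => x; rewrite indicE; congr (_%:R); apply/esym; rewrite /S mem_setE.
have [_ _] := @dominated_convergence _ _ R mu Omega mO
   (fun k x => (g x * eta k x)%:E) (EFin \o f) (EFin \o (fun x => `|g x|))
   (fun k => measurable_int _ (Ieta k)) ((measurable_EFinP _ _).2 mf)
   ltac:(
     apply: aeW => x _; apply: cvg_EFin; [exact: nearW|];
     apply: cvgMr; rewrite (_ : (psi x != 0)%:R = 1 - (psi x == 0)%:R);
       [under eq_fun do rewrite etaE; apply: cvgB; [exact: cvg_cst|exact: ratio_cvg]
       |by case: eqP => _ /=; rewrite ?subrr ?subr0])
   (itg_norm Ig)
   ltac:(apply: aeW => x k _; rewrite /= lee_fin normrM ler_piMr//).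
under eq_fun do rewrite -(EFin_Rintegral mO (Ieta _)) H//.
move=> /(cvg_lim (@ereal_hausdorff _)); rewrite lim_cst// => h.
rewrite -/S -{1}(setIidr SO) integral_mkcondr [RHS]h; apply: eq_integral => x _.
rewrite patchE /f /=; case: ifPn => [|]; rewrite ?inE ?notin_setE/S/=.
  by move=> ->; rewrite mulr1.
by move=> /negP/negbNE/eqP ->; rewrite eqxx mulr0.
Qed.

Let boxes := [set B : set 'rV[R]_n | exists a b, B = obox a b].

Lemma measurable_rV_boxes : @measurable _ 'rV[R]_n = <<s boxes >>.
Proof.
apply/seteqP; split; last first.
  apply: smallest_sub; first exact: sigma_algebra_measurable.
  by move=> _ [a [b ->]]; exact: measurable_obox.
apply: smallest_sub; first exact: smallest_sigma_algebra.
have open_boxes (U : set 'rV[R]_n) : open U -> <<s boxes >> U.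
  move=> oU.
  have -> : U = \bigcup_(q : 'rV[rat]_n * nat)
    (if `[< cbox (rat_lo R q) (rat_hi R q) `<=` U >] then
       obox (rat_lo R q) (rat_hi R q) else set0).
    apply/seteqP; split => [x Ux|x [q _]]; last first.
      by case: ifPn => // /asboolP qU /sub_obox_cbox/qU.
    have [q [qx qU]] := open_rat_box oU Ux.
    by exists q => //; rewrite ifT//; apply/asboolP.
  apply: (@countable_bigcupT_measurable _ (g_sigma_algebraType boxes)).
    exact: countable_rat_boxes.
  move=> q; case: ifP => // _.
  by apply: sub_sigma_algebra; exists (rat_lo R q), (rat_hi R q).
move=> A; rewrite -bigcup_seq/= => -[i _ [Y mY <-]].
have mc : measurable_fun [set: g_sigma_algebraType boxes]
    (fun x : 'rV[R]_n => x ord0 i : R).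
  apply: (measurability _ (RGenOpens.measurableE R)).
  move=> _ [_ [a [b ->] <-]]; rewrite setTI; apply: open_boxes.
  by apply: open_comp; [move=> x _; exact: coord_continuous|exact: interval_open].
exact: mc.
Qed.

Lemma setI_closed_boxes : setI_closed boxes.
Proof.
move=> _ _ [a [b ->]] [c [e ->]].
exists (\row_i Num.max (a ord0 i) (c ord0 i)), (\row_i Num.min (b ord0 i) (e ord0 i)).
apply/seteqP; split => x /=.
  move=> [h k] i; rewrite !mxE gt_max lt_min.
  by have /andP[-> ->] := h i; have /andP[-> ->] := k i.
move=> h; split => i; have := h i; rewrite !mxE gt_max lt_min.
  by move=> /andP[/andP[-> _] /andP[-> _]].
by move=> /andP[/andP[_ ->] /andP[_ ->]].
Qed.

(** On a closed cube inside Omega, products of bumps make the integral of [g] vanish over every open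
    box intersected with the open cube. Dynkin's lemma extends this to all measurable subsets of the
    open cube, so [g] vanishes almost everywhere there, and countably many such cubes cover
    Omega. *)
Lemma fundamental_lemma (g : 'rV[R]_n -> R) :
  itg mu Omega g ->
  (forall psi, test_function Omega psi ->
    \int[mu]_(x in Omega) (g x * psi x) = 0) ->
  {ae mu, forall x, Omega x -> g x = 0}.
Proof.
move=> Ig H.
suff box q : cbox (rat_lo R q) (rat_hi R q) `<=` Omega ->
    {ae mu, forall x, obox (rat_lo R q) (rat_hi R q) x -> g x = 0}.
  have [Z [mZ Z0 ZP]] : {ae mu, forall x, forall m : nat,
      if (unpickle m : option ('rV[rat]_n * nat)) is Some q then
        cbox (rat_lo R q) (rat_hi R q) `<=` Omega ->
        obox (rat_lo R q) (rat_hi R q) x -> g x = 0 else True}.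
    (* A countable intersection of full-measure sets is indexed by naturals, hence the numbering of
       the cubes through [unpickle]. *)
    apply: ae_foralln => m; case: unpickle => [q|]; last exact: aeW.
    have [qO|qO] := pselect (cbox (rat_lo R q) (rat_hi R q) `<=` Omega).
      by have := box q qO; apply: filterS => x h _.
    by apply: aeW.
  exists Z; split => // x /= hx; apply: ZP => /= h; apply: hx => Ox.
  have [q [qx qO]] := open_rat_box oO Ox.
  by have := h (pickle q); rewrite pickleK; exact.
set a := rat_lo R q; set b := rat_hi R q => abO.
pose psi0 := box_bump a b.
have t0 : test_function Omega psi0 by exact: test_bump.
have QO : obox a b `<=` Omega by move=> x /sub_obox_cbox/abO.
have mQ := measurable_obox a b.
have IgQ : mu.-integrable (obox a b) (EFin \o g) by exact: integrableS Ig.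
have QE : [set x | psi0 x != 0] = obox a b.
  by apply/seteqP; split => x /=; rewrite box_bump_neq0.
pose P (A : set 'rV[R]_n) := (\int[mu]_(x in A `&` obox a b) (g x)%:E = 0)%E.
(* The integral over the whole cube is what gives both the full set and the stability under
   complements in the Dynkin class. *)
have Q0 : (\int[mu]_(x in obox a b) (g x)%:E = 0)%E.
  by rewrite -QE; apply: test_support_integral0.
have PA A : <<s boxes >> A -> P A.
  apply: (dynkin_induction measurable_rV_boxes setI_closed_boxes).
  - by rewrite /P setTI.
  - move=> _ [c [e ->]]; rewrite /P.
    pose psi x := box_bump c e x * psi0 x.
    have -> : obox c e `&` obox a b = [set x | psi x != 0].
      apply/seteqP; split => x /=.
        by move=> [/box_bump_neq0 h1 /box_bump_neq0 h2]; rewrite mulf_neq0.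
      by rewrite mulf_eq0 negb_or => /andP[/box_bump_neq0 h1 /box_bump_neq0 h2].
    apply: test_support_integral0 => //.
    by apply: test_smul => //; exact: smooth_box_bump.
  - move=> B mB PB; rewrite /P.
    move: Q0; rewrite -{1}(setTI (obox a b)) -(setUv B) setIUl integral_setU//.
    + by rewrite PB add0e.
    + exact: measurableI.
    + by apply: measurableI => //; exact: measurableC.
    + rewrite -setIUl setUv setTI; exact: measurable_int IgQ.
    + by apply/disj_setPS => x [[Ax _] []].
  - move=> F mF tF PF; rewrite /P setI_bigcupl.
    rewrite integral_bigcup//.
    + by apply: eseries0 => i _ _; exact: PF.
    + by apply: trivIset_setIr.
    + by move=> k; exact: measurableI.
    + rewrite -setI_bigcupl; apply: integrableS IgQ => //.
      by apply: measurableI => //; exact: bigcup_measurable.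
have := @integral_ae_eq _ _ R mu (obox a b) mQ (cst 0%E) (EFin \o g) IgQ.
move=> /(_ (measurable_cst _)); case.
  move=> E EQ mE; rewrite integral_cst// mul0e -{1}(setIidl EQ).
  by apply: PA; rewrite -measurable_rV_boxes.
move=> Z [mZ Z0 ZP]; exists Z; split => // x hx; apply: ZP => h; apply: hx => Qx.
by have [] := h Qx.
Qed.

End fundamental.

(** * The integral of a partial derivative *)

Lemma integral_derivative0 (R : realType) (f g : R -> R) (r : R) : 0 < r ->
  (forall t : R, is_derive t 1 f (g t)) -> continuous g ->
  (forall t, r < `|t| -> f t = 0) ->
  (\int[@lebesgue_measure R]_t (g t)%:E = 0)%E.
Proof.
move=> r0 dfg cg f0.
have cf : continuous f.
  by move=> t; apply/differentiable_continuous/derivable1_diffP; have [] := dfg t.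
have gE : derive1 f = g by apply/funext => t; rewrite derive1E; have [] := dfg t.
have g0 t : r < `|t| -> g t = 0.
  move=> rt; rewrite -gE derive1E.
  rewrite (@near_eq_derive _ _ _ f (cst 0)) ?derive_cst//.
  have rn : \forall s \near t, r < `|s| by exact: (cvgr_gt _ (@norm_continuous R R t)).
  by apply: filterS rn => s; exact: f0.
(* [f] is assumed to vanish only for r < |t|, so the endpoints are taken strictly beyond r. *)
pose a := r + 1.
have ra : r < `|a| by rewrite ger0_norm /a; [rewrite ltrDl|rewrite addr_ge0// ltW].
have aa : - a < a by rewrite /a; lra.
pose I : set R := `[(- a), a]%classic.
transitivity (\int[@lebesgue_measure R]_(t in I) (g t)%:E)%E.
  rewrite [RHS]integral_mkcond; apply: eq_integral => t _.
  rewrite patchE; case: ifPn => //; rewrite notin_setE/I/= in_itv/= -ler_norml => /negP.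
  by rewrite -ltNge => ta; rewrite g0//; apply: lt_trans ta; rewrite /a ltrDl.
rewrite /I (@continuous_FTC2 _ g f)//.
- by rewrite !f0 ?normrN// subee.
- exact: continuous_subspaceT.
- split.
  + by move=> t _; have [] := dfg t.
  + by apply: cvg_at_right_filter; exact: cf.
  + by apply: cvg_at_left_filter; exact: cf.
- by move=> t _; rewrite gE.
Qed.

Lemma continuous_rV (T : topologicalType) (R : realType) n (f : T -> 'rV[R]_n) :
  (forall i, continuous (fun x => f x ord0 i)) -> continuous f.
Proof.
move=> cf x B [P hP PB].
suff : \forall y \near x, forall i, P ord0 i (f y ord0 i).
  by apply: filterS => y h; apply: PB => i j; rewrite (ord1 i).
by apply: filter_forall => i; apply: cf; exact: hP.
Qed.

Section divergence.
Context (R : realType).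
Local Notation mu n := (@lebesgue_rV R n).

Lemma rV_cons_lift n (t : R) (y : 'rV[R]_n) j :
  rV_cons (t, y) ord0 (lift ord0 j) = y ord0 j.
Proof. by rewrite mxE liftK. Qed.

Lemma rV_cons_ord0 n (t : R) (y : 'rV[R]_n) : rV_cons (t, y) ord0 ord0 = t.
Proof. by rewrite mxE unlift_none. Qed.

Lemma rV_consD0 n (s t : R) (y : 'rV[R]_n) :
  rV_cons (s + t, y) = s *: delta_mx ord0 ord0 + rV_cons (t, y).
Proof.
apply/rowP => i; rewrite !mxE; case: (unliftP ord0 i) => [j|] ->.
  by rewrite /= mulr0 add0r.
by rewrite !eqxx mulr1.
Qed.

Lemma rV_consD n (s t : R) (y : 'rV[R]_n) j :
  rV_cons (t, s *: delta_mx ord0 j + y) =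
  s *: delta_mx ord0 (lift ord0 j) + rV_cons (t, y).
Proof.
apply/rowP => i; rewrite !mxE; case: (unliftP ord0 i) => [k|] ->.
  by rewrite /= !mxE !eqxx/= (inj_eq lift_inj).
by rewrite /= mulr0 add0r.
Qed.

(** Support in a cube, phrased coordinate by coordinate so that it passes to the slices obtained by
    fixing some of the arguments of [rV_cons]. *)
Definition supported n (r : R) (f : 'rV[R]_n -> R) :=
  forall (x : 'rV[R]_n) i, r < `|x ord0 i| -> f x = 0.

Lemma partial_supported n r (f : 'rV[R]_n -> R) i :
  supported r f -> supported r (partial i f).
Proof.
move=> f0 x j rx; rewrite /partial.
rewrite (@near_eq_derive _ _ _ f (cst 0)) ?derive_cst//.
have cn : `|(y : 'rV[R]_n) ord0 j| @[y --> x] --> `|x ord0 j|.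
  exact: (continuous_comp (@coord_continuous R 1 n ord0 j x) (@norm_continuous R R _)).
have rn : \forall y \near x, r < `|(y : 'rV[R]_n) ord0 j| by exact: (cvgr_gt _ cn).
by apply: filterS rn => y; exact: f0.
Qed.

Lemma supported_integrable n r (f : 'rV[R]_n -> R) : 0 < r ->
  continuous f -> supported r f -> (mu n).-integrable setT (EFin \o f).
Proof.
move=> r0 cf f0.
pose B := cbox (const_mx (- r) : 'rV[R]_n) (const_mx r).
have mB : measurable B by exact: measurable_cbox.
have mf := continuous_measurable_rV cf.
have fE : f = f \_ B.
  apply/funext => x; rewrite patchE; case: ifPn => //.
  rewrite notin_setE => /existsNP[i]; rewrite !mxE -ler_norml => /negP.
  by rewrite -ltNge; exact: f0.
have /compact_bounded[M [_ hM]] : compact (f @` B).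
  apply: continuous_compact; [exact: continuous_subspaceT|exact: compact_cbox].
rewrite fE -restrict_EFin; apply/integrable_restrict => //; rewrite setTI.
apply: measurable_bounded_integrable => //.
- exact: cbox_lty.
- exact: measurable_funTS.
- exists M; split; first exact: num_real.
  by move=> K MK x Bx; apply: hM => //; exists x.
Qed.

Lemma integral_rV_cons n (f : 'rV[R]_n.+1 -> R) r : 0 < r ->
  continuous f -> supported r f ->
  (@lebesgue_measure R \x mu n)%E.-integrable setT (EFin \o (f \o @rV_cons R n)) /\
  (\int[mu n.+1]_x (f x)%:E =
   \int[(@lebesgue_measure R \x mu n)%E]_p (f (rV_cons p))%:E)%E.
Proof.
move=> r0 cf f0; have If := supported_integrable r0 cf f0.
have mf : measurable_fun [set: 'rV[R]_n.+1] (EFin \o f) by exact: measurable_int If.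
have mc := @measurable_rV_cons R n.
have Ic : (@lebesgue_measure R \x mu n)%E.-integrable setT (EFin \o (f \o @rV_cons R n)).
  apply/integrableP; split.
    apply/measurable_EFinP; apply: measurableT_comp => //.
    exact/measurable_EFinP.
  move/integrableP: If => [_].
  rewrite /= /lebesgue_rV_step ge0_integral_pushforward//.
  by apply/measurable_EFinP/measurableT_comp => //; exact/measurable_EFinP.
split => //.
by rewrite /= /lebesgue_rV_step integral_pushforward.
Qed.

(** Induction on the dimension. The direction decides the order in Fubini: if it is the first
    coordinate, that variable is integrated first by [integral_derivative0]; otherwise the remaining
    variables are integrated first by the induction hypothesis. Either way the inner integral is
    0. *)
Lemma integral_partial0 n (f : 'rV[R]_n -> R) i r : 0 < r ->
  (forall x, derivable f x (delta_mx ord0 i)) -> continuous (partial i f) ->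
  supported r f -> (\int[mu n]_x (partial i f x)%:E = 0)%E.
Proof.
move=> r0; elim: n f i => [|n IH] f i; first by case: i.
move=> df cdf f0.
have s0 := partial_supported i f0.
have [Ic ->] := integral_rV_cons r0 cdf s0.
have dfi x : is_derive x (delta_mx ord0 i) f (partial i f x) by exact: derivableP.
case: (unliftP ord0 i) => [j|] iE; subst i.
- rewrite -(integral12_prod_meas1 Ic) /fubini_F.
  rewrite integral0_eq// => t _ /=.
  pose h y := f (rV_cons (t, y)).
  have dh y : is_derive y (delta_mx ord0 j) h (partial (lift ord0 j) f (rV_cons (t, y))).
    apply/is_derive_line; rewrite /h.
    under [X in is_derive _ _ X _]eq_fun do rewrite rV_consD.
    exact: ((is_derive_line _ _ _ _).1 (dfi _)).
  have hE : partial j h = fun y => partial (lift ord0 j) f (rV_cons (t, y)).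
    by apply/funext => y; rewrite /partial; have [] := dh y.
  rewrite -(IH h j).
  + by rewrite hE.
  + by move=> y; have [] := dh y.
  + rewrite hE => y; apply: continuous_comp; last exact: cdf.
    apply: continuous_rV => k; case: (unliftP ord0 k) => [l|] ->.
      under eq_fun do rewrite rV_cons_lift; exact: coord_continuous.
    by under eq_fun do rewrite rV_cons_ord0; exact: cst_continuous.
  + by move=> y k ry; apply: (f0 _ (lift ord0 k)); rewrite rV_cons_lift.
- rewrite -(integral21_prod_meas1 Ic) /fubini_G.
  rewrite integral0_eq// => y _ /=.
  apply: (@integral_derivative0 _ (fun t => f (rV_cons (t, y)))
    (fun t => partial ord0 f (rV_cons (t, y))) r r0).
  + move=> t; apply/is_derive_line.
    under [X in is_derive _ _ X _]eq_fun do rewrite [_ *: 1]mulr1 rV_consD0.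
    exact: ((is_derive_line _ _ _ _).1 (dfi _)).
  + move=> t; apply: continuous_comp; last exact: cdf.
    apply: continuous_rV => k; case: (unliftP ord0 k) => [l|] ->.
      by under eq_fun do rewrite rV_cons_lift; exact: cst_continuous.
    by under eq_fun do rewrite rV_cons_ord0; move=> s.
  + by move=> t rt; apply: (f0 _ ord0); rewrite rV_cons_ord0.
Qed.

Lemma test_integral_partial0 n (Omega : set 'rV[R]_n) (f : 'rV[R]_n -> R) i :
  open Omega -> test_function Omega f ->
  \int[mu n]_(x in Omega) partial i f x = 0.
Proof.
move=> oO tf; have mO := open_measurable_rV oO.
have [sf [K [cK KO fK]]] := tf.
have [r [r0 hr]] := bounded_set_coord (compact_bounded cK).
have s0 : supported r f.
  by move=> x j rx; apply: fK => Kx; have := hr x j Kx; rewrite leNgt rx.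
have [_ df Cdf] := CkS_inv (sf 1%N).
have [_ [K' [_ K'O fK']]] := test_partial i tf.
rewrite Rintegral_mkcond /Rintegral.
rewrite [X in fine X](_ : _ = (\int[mu n]_x (partial i f x)%:E)%E).
  rewrite (@integral_partial0 _ _ _ r)//.
  exact: (Ck_continuous (Cdf i)).
apply: eq_integral => x _; rewrite patchE; case: ifPn => //.
by rewrite notin_setE => Ox; rewrite fK'// => /K'O.
Qed.

End divergence.

(** * Square-integrable functions *)

Section L2.
Context d (T : measurableType d) (R : realType)
  (mu : {measure set T -> \bar R}) (D : set T) (mD : measurable D).
Implicit Types f g : T -> R.

Definition L2 f := measurable_fun D f /\ itg mu D (fun x => f x ^+ 2).

Lemma L2_mul_itg f g : L2 f -> L2 g -> itg mu D (fun x => f x * g x).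
Proof.
move=> [mf If] [mg Ig]; apply: (itg_le mD _ _ (itgD mD If Ig)).
  exact: measurable_funM.
by move=> x _; rewrite ler_norml; apply/andP; split; nra.
Qed.

Lemma L2_bounded f g C : L2 f -> measurable_fun D g ->
  (forall x, D x -> `|g x| <= C) -> L2 (fun x => f x * g x).
Proof.
move=> [mf If] mg gC; split; first exact: measurable_funM.
rewrite (_ : (fun x => _) = (fun x => f x ^+ 2 * g x ^+ 2)); last first.
  by apply/funext => x; rewrite exprMn.
apply: (@itg_mul_bounded _ _ _ _ _ mD (C ^+ 2)) => //.
  exact: measurable_funX.
move=> x Dx; rewrite normrX lerXn2r ?nnegrE//; last exact: gC.
exact: le_trans (gC x Dx).
Qed.

Lemma L2D f g : L2 f -> L2 g -> L2 (fun x => f x + g x).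
Proof.
move=> Lf Lg; have Ifg := L2_mul_itg Lf Lg; move: Lf Lg => [mf If] [mg Ig].
split; first exact: measurable_funD.
rewrite (_ : (fun x => _) =
    (fun x => f x ^+ 2 + (2 * (f x * g x) + g x ^+ 2))); last first.
  by apply/funext => x; ring.
by apply: itgD => //; apply: itgD => //; exact: itgZ.
Qed.

Lemma L2Z (c : R) f : L2 f -> L2 (fun x => c * f x).
Proof.
move=> Lf; rewrite (_ : (fun x => _) = (fun x => f x * cst c x)).
  by apply: (@L2_bounded _ _ `|c|).
by apply/funext => x; rewrite mulrC.
Qed.

Lemma L2B f g : L2 f -> L2 g -> L2 (fun x => f x - g x).
Proof.
move=> Lf Lg; rewrite (_ : (fun x => _) = (fun x => f x + -1 * g x)).
  by apply: L2D => //; exact: L2Z.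
by apply/funext => x; rewrite mulN1r.
Qed.

Lemma L2_norm f : L2 f -> L2 (fun x => `|f x|).
Proof.
move=> [mf If]; split; first exact: measurableT_comp.
rewrite (_ : (fun x => _) = (fun x => f x ^+ 2))//.
by apply/funext => x; rewrite real_normK// num_real.
Qed.

Lemma L2_le f g : measurable_fun D f -> L2 g ->
  (forall x, D x -> `|f x| <= `|g x|) -> L2 f.
Proof.
move=> mf [mg Ig] fg; split=> //; apply: (itg_le mD _ _ Ig).
  exact: measurable_funX.
move=> x Dx; rewrite normrX -(real_normK (num_real (g x))).
by rewrite lerXn2r ?nnegrE//; exact: fg.
Qed.

(** Continuity of the pairing with [g], from |f g| <= l f^2 + l^-1 g^2. The weight l depends on [g]
    and [e] only, and the threshold [dl] is chosen after l. *)
Lemma L2_pairing_small g e : L2 g -> 0 < e -> exists2 dl, 0 < dl &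
  forall f, L2 f -> \int[mu]_(x in D) (f x ^+ 2) <= dl ->
    \int[mu]_(x in D) `|f x * g x| <= e.
Proof.
move=> Lg e0; pose G := \int[mu]_(x in D) (g x ^+ 2).
have G0 : 0 <= G by apply: Rintegral_ge0 => x _; exact: sqr_ge0.
(* This makes l^-1 G at most e / 2, and the added 1 keeps l positive when G = 0. The threshold e /
   (2 l) takes care of the other half. *)
pose l := 2 * (G + 1) / e.
have l0 : 0 < l by rewrite /l divr_gt0// mulr_gt0// ltr_wpDl.
exists (e / (2 * l)); first by rewrite divr_gt0// mulr_gt0.
move=> f Lf fd.
have I1 := itgZ mD l (proj2 Lf); have I2 := itgZ mD l^-1 (proj2 Lg).
apply: (@le_trans _ _ (\int[mu]_(x in D) (l * f x ^+ 2 + l^-1 * g x ^+ 2))).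
  apply: le_Rintegral => //.
  - by apply: itg_norm => //; exact: L2_mul_itg.
  - exact: itgD.
  - move=> x _; have ll : l * l^-1 = 1 by rewrite divff// gt_eqF.
    have li : 0 < l^-1 by rewrite invr_gt0.
    have h1 : 0 <= l * (f x - l^-1 * g x) ^+ 2 by rewrite mulr_ge0 ?sqr_ge0// ltW.
    have h2 : 0 <= l * (f x + l^-1 * g x) ^+ 2 by rewrite mulr_ge0 ?sqr_ge0// ltW.
    have e1 : l * (f x - l^-1 * g x) ^+ 2 =
        l * f x ^+ 2 - 2 * (l * l^-1) * (f x * g x) + l * l^-1 * (l^-1 * g x ^+ 2).
      by ring.
    have e2 : l * (f x + l^-1 * g x) ^+ 2 =
        l * f x ^+ 2 + 2 * (l * l^-1) * (f x * g x) + l * l^-1 * (l^-1 * g x ^+ 2).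
      by ring.
    rewrite e1 ll in h1; rewrite e2 ll in h2.
    have h3 : 0 <= l * f x ^+ 2 by rewrite mulr_ge0 ?sqr_ge0// ltW.
    have h4 : 0 <= l^-1 * g x ^+ 2 by rewrite mulr_ge0 ?sqr_ge0// ltW.
    by rewrite ler_norml; apply/andP; split; lra.
rewrite RintegralD// RintegralZl ?RintegralZl//; [|exact: (proj2 Lg)|exact: (proj2 Lf)].
rewrite -/G.
have h1 : l * \int[mu]_(x in D) f x ^+ 2 <= e / 2.
  apply: (@le_trans _ _ (l * (e / (2 * l)))); first by rewrite ler_pM2l.
  by rewrite le_eqVlt; apply/orP; left; apply/eqP; field; rewrite gt_eqF.
have h2 : l^-1 * G <= e / 2.
  rewrite mulrC ler_pdivrMr// (_ : e / 2 * l = G + 1) ?lerDl//.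
  by rewrite /l; field; rewrite gt_eqF.
lra.
Qed.

Hypothesis Dfin : (mu D < +oo)%E.

Lemma itg_cst c : itg mu D (fun _ => c).
Proof.
apply: measurable_bounded_integrable => //.
exists `|c|; split; first exact: num_real.
by move=> x cx y _ /=; exact: ltW.
Qed.

Lemma L2_cst c : L2 (fun _ => c).
Proof.
split; first exact: measurable_cst.
exact: itg_cst.
Qed.

Lemma L2_itg f : L2 f -> itg mu D f.
Proof.
move=> Lf; have := L2_mul_itg Lf (L2_cst 1).
by under eq_fun do rewrite mulr1.
Qed.

(** Split at |a| = s: beyond it, a^2 is |a|^n divided by |a|^(n-2), which is at least s^(n-2).
    Taking s = 1 embeds L^n in L^2 on a set of finite measure; taking s small transfers
    convergence. *)
Lemma sqr_le_pow (s a : R) n : 0 < s -> (2 <= n)%N ->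
  a ^+ 2 <= s ^+ 2 + (s ^+ (n - 2))^-1 * `|a| ^+ n.
Proof.
move=> s0 n2; rewrite -(real_normK (num_real a)).
have [as_|sa] := leP `|a| s.
  apply: (@le_trans _ _ (s ^+ 2)); first by rewrite lerXn2r ?nnegrE// ltW.
  by rewrite lerDl mulr_ge0 ?invr_ge0 ?exprn_ge0// ltW.
apply: (@le_trans _ _ ((s ^+ (n - 2))^-1 * `|a| ^+ n)); last by rewrite lerDr sqr_ge0.
rewrite mulrC ler_pdivlMr ?exprn_gt0// -{2}(subnK n2) exprD mulrC.
by rewrite ler_wpM2r ?exprn_ge0// lerXn2r ?nnegrE// ltW.
Qed.

Lemma Rintegral_sqr_le (s : R) n f : 0 < s -> (2 <= n)%N ->
  itg mu D (fun x => f x ^+ 2) -> itg mu D (fun x => `|f x| ^+ n) ->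
  \int[mu]_(x in D) (f x ^+ 2) <=
  s ^+ 2 * fine (mu D) + (s ^+ (n - 2))^-1 * \int[mu]_(x in D) (`|f x| ^+ n).
Proof.
move=> s0 n2 I2 In; have Isn := itgZ mD (s ^+ (n - 2))^-1 In.
rewrite -RintegralZl// -(Rintegral_cst mu mD) -RintegralD//; last exact: itg_cst.
apply: le_Rintegral => //; first by apply: itgD => //; exact: itg_cst.
by move=> x _; exact: sqr_le_pow.
Qed.

End L2.

(** * From L^p to L^2 on a set of finite measure *)

Section Lp.
Context (R : realType) (n : nat) (Omega : set 'rV[R]_n).
Hypothesis oO : open Omega.
Local Notation mu := (@lebesgue_rV R n).
Hypothesis Ofin : (mu Omega < +oo)%E.
Implicit Types (u : 'rV[R]_n -> R) (p : nat).

Let mO : measurable Omega. Proof. exact: open_measurable_rV. Qed.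

Lemma Lnorm_restrictE p u : (0 < p)%N ->
  ('N[mu]_(p%:R%:E)[EFin \o (u \_ Omega)%function] `^ p%:R)%E =
  (\int[mu]_(x in Omega) (`|u x| ^+ p)%:E)%E.
Proof.
move=> p0; rewrite poweR_Lnorm ?pnatr_eq0 -?lt0n//.
rewrite [RHS]integral_mkcond; apply: eq_integral => x _.
rewrite /= !patchE; case: ifPn => _ /=.
  by rewrite powR_mulrn.
by rewrite normr0 powR0// pnatr_eq0 -lt0n.
Qed.

Lemma Lp_itg p u : (0 < p)%N -> Lp Omega p%:R u ->
  measurable_fun Omega u /\ itg mu Omega (fun x => `|u x| ^+ p).
Proof.
move=> p0; rewrite /Lp inE => /andP[/[!inE]/= mu1 fin].
have mf : measurable_fun Omega u.
  by apply/(measurable_restrictT u mO).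
split => //; apply/integrableP; split.
  by apply/measurable_EFinP; apply: measurable_funX; exact: measurableT_comp.
have := poweR_lty p%:R fin; rewrite Lnorm_restrictE//.
apply: le_lt_trans; rewrite le_eqVlt; apply/orP; left; apply/eqP.
by apply: eq_integral => x _ /=; rewrite ger0_norm// exprn_ge0.
Qed.

Lemma Lp_L2 p u : (2 <= p)%N -> Lp Omega p%:R u -> L2 mu Omega u.
Proof.
move=> p2 /(Lp_itg (ltnW p2))[mf If]; split => //.
have I1 := @itg_cst _ _ R mu Omega mO Ofin 1.
apply: (itg_le mO _ _ (itgD mO I1 If)); first exact: measurable_funX.
move=> x _; rewrite ger0_norm ?sqr_ge0//.
by have := sqr_le_pow (u x) ltr01 p2; rewrite !expr1n invr1 mul1r.
Qed.

Lemma cvg_Lp_L2 p (u_ : nat -> 'rV[R]_n -> R) u e : (2 <= p)%N ->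
  (forall k, L2 mu Omega (fun x => u_ k x - u x)) ->
  cvg_Lp Omega p%:R u_ u -> 0 < e ->
  \forall k \near \oo, \int[mu]_(x in Omega) ((u_ k x - u x) ^+ 2) <= e.
Proof.
move=> p2 Lu cu e0; have p0 := ltnW p2.
have [V VE] : exists V, mu Omega = V%:E.
  by exists (fine (mu Omega)); rewrite fineK// ge0_fin_numE.
have V0 : 0 <= V by rewrite -lee_fin -VE.
have [s [s0 sV]] : exists s : R, 0 < s /\ s ^+ 2 * V <= e / 2.
  pose q := e / (2 * (V + 1)).
  have q0 : 0 < q by rewrite divr_gt0// mulr_gt0// ltr_wpDl.
  exists (Num.sqrt q); split; first by rewrite sqrtr_gt0.
  rewrite sqr_sqrtr ?(ltW q0)// /q mulrAC ler_pdivrMr ?mulr_gt0// ?ltr_wpDl//.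
  by nra.
pose S := s ^+ (p - 2).
have S0 : 0 < S by rewrite exprn_gt0.
(* The bound 1 gives t^p <= t, so the integral of |f|^p is at most t as soon as the norm is; the
   other bound gives S^-1 t <= e / 2. *)
pose t := Num.min 1 (e / 2 * S).
have t0 : 0 < t by rewrite lt_min ltr01/= mulr_gt0// divr_gt0.
have near_t : \forall k \near \oo, ('N[mu]_(p%:R%:E)[EFin \o ((u_ k \- u)%R \_ Omega)%function] < t%:E)%E.
  have h : ereal_nbhs (0%E : \bar R) (fun x => (x < t%:E)%E).
    by apply: open_ereal_lt'; rewrite lte_fin.
  exact: (cu _ h).
apply: filterS near_t => k ht.
set f := (u_ k \- u)%R in ht.
have : (\int[mu]_(x in Omega) (`|f x| ^+ p)%:E <= t%:E)%E.
  rewrite -Lnorm_restrictE//.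
  apply: (@le_trans _ _ (t%:E `^ p%:R)%E).
    apply: gt0_ler_poweR => //; rewrite ?in_itv/= ?leey ?andbT ?lee_fin ?(ltW t0)//.
      exact: Lnorm_ge0.
    exact: ltW.
  rewrite poweR_EFin lee_fin powR_mulrn ?(ltW t0)//.
  by rewrite -(prednK p0) exprS ler_piMr ?(ltW t0)// exprn_ile1 ?(ltW t0)// ge_min lexx.
move=> ht1.
have mf : measurable_fun Omega f by have [] := Lu k.
have Ip : itg mu Omega (fun x => `|f x| ^+ p).
  apply/integrableP; split.
    by apply/measurable_EFinP; apply: measurable_funX; exact: measurableT_comp.
  apply: le_lt_trans (ltry t); apply: le_trans ht1; rewrite le_eqVlt; apply/orP; left; apply/eqP.
  by apply: eq_integral => x _ /=; rewrite ger0_norm// exprn_ge0.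
rewrite -EFin_Rintegral// lee_fin in ht1.
apply: (@le_trans _ _ (s ^+ 2 * V + S^-1 * \int[mu]_(x in Omega) (`|f x| ^+ p))).
  rewrite (_ : V = fine (mu Omega)); last by rewrite VE.
  exact: (Rintegral_sqr_le mO Ofin s0 p2 (proj2 (Lu k)) Ip).
have : S^-1 * \int[mu]_(x in Omega) `|f x| ^+ p <= e / 2.
  rewrite mulrC ler_pdivrMr//; apply: le_trans ht1 _.
  by rewrite ge_min lexx orbT.
by move: sV; lra.
Qed.

End Lp.

(** * Identities passing to the closure of the test functions *)

Section sobolev_calculus.
Context (R : realType) (n : nat) (Omega : set 'rV[R]_n).
Hypothesis oO : open Omega.
Local Notation mu := (@lebesgue_rV R n).
Hypothesis Ofin : (mu Omega < +oo)%E.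
Implicit Types (u w phi psi : 'rV[R]_n -> R) (D E : 'rV[R]_n -> 'rV[R]_n).

Let mO : measurable Omega. Proof. exact: open_measurable_rV. Qed.

Lemma smooth_coord i : smooth (fun x : 'rV[R]_n => x ord0 i : R).
Proof. by move=> k; exact: Ck_coord. Qed.

Lemma test_L2 phi : test_function Omega phi -> L2 mu Omega phi.
Proof.
move=> tp; have [C [C0 hC]] := test_bounded tp.
apply: (@L2_le _ _ _ mu _ mO _ (fun=> C)); first exact: test_measurable tp.
  exact: L2_cst.
by move=> x _; rewrite (ger0_norm C0).
Qed.

Lemma L2_mul_test u psi : L2 mu Omega u -> test_function Omega psi ->
  L2 mu Omega (fun x => u x * psi x).
Proof.
move=> Lu tp; have [C [C0 hC]] := test_bounded tp.
apply: (@L2_bounded _ _ _ mu _ mO _ _ C) => //; exact: test_measurable tp.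
Qed.

(** What the later arguments retain of W_0^{1,p}: a single test function close in L^2 to [w] and,
    with all its partial derivatives, to [D]. The exponent p has disappeared. *)
Definition approximable w D := forall dl : R, 0 < dl ->
  exists2 phi, test_function Omega phi &
    \int[mu]_(x in Omega) ((phi x - w x) ^+ 2) <= dl /\
    forall i, \int[mu]_(x in Omega) ((partial i phi x - D x ord0 i) ^+ 2) <= dl.

Lemma sobolev0_approximable p w D : (2 <= p)%N ->
  sobolev0 Omega p%:R w D -> approximable w D.
Proof.
move=> p2 [[Lw LD _] [phi [tphi cphi cdphi]]] dl dl0.
have Lw2 := Lp_L2 oO Ofin p2 Lw.
have LD2 i := Lp_L2 oO Ofin p2 (LD i).
have L1 k : L2 mu Omega (fun x => phi k x - w x).
  by apply: L2B => //; exact: test_L2.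
have L2i i k : L2 mu Omega (fun x => partial i (phi k) x - D x ord0 i).
  by apply: L2B => //; apply: test_L2; exact: test_partial.
have near_all : \forall k \near \oo, forall i,
    \int[mu]_(x in Omega) ((partial i (phi k) x - D x ord0 i) ^+ 2) <= dl.
  apply: filter_forall => i.
  exact: (cvg_Lp_L2 oO Ofin p2 (L2i i) (cdphi i) dl0).
have [k [h1 h2]] := filter_ex (filterI (cvg_Lp_L2 oO Ofin p2 L1 cphi dl0) near_all).
by exists (phi k).
Qed.

Lemma eq0_small (x : R) : (forall e : R, 0 < e -> `|x| <= e) -> x = 0.
Proof.
move=> h; apply/eqP; rewrite -normr_eq0; apply: contraT => x0.
have x1 : 0 < `|x| by rewrite lt_def x0 normr_ge0.
by have := h (`|x| / 2) (divr_gt0 x1 (ltr0Sn _ _)); lra.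
Qed.

Lemma Rintegral_approx (f g h : 'rV[R]_n -> R) e :
  itg mu Omega f -> itg mu Omega g -> itg mu Omega h ->
  (forall x, Omega x -> `|f x - g x| <= h x) ->
  \int[mu]_(x in Omega) g x = 0 -> \int[mu]_(x in Omega) h x <= e ->
  `|\int[mu]_(x in Omega) f x| <= e.
Proof.
move=> If Ig Ih fgh g0 he; apply: le_trans he.
have -> : \int[mu]_(x in Omega) f x = \int[mu]_(x in Omega) (f x - g x).
  by rewrite RintegralB// g0 subr0.
apply: le_trans (le_normr_Rintegral mO (itgB mO If Ig)) _.
apply: le_Rintegral => //; apply: itg_norm => //; exact: itgB.
Qed.

(** With L^2 coefficients [a] and [b] the integral is continuous in phi and its partial derivative,
    so an identity valid for all test functions extends to the pair [w], [D]. Products of several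
    approximable factors are reached by applying it to one factor at a time. *)
Lemma approximable_linear w D i a b : approximable w D ->
  L2 mu Omega w -> L2 mu Omega (fun x => D x ord0 i) ->
  L2 mu Omega a -> L2 mu Omega b ->
  (forall phi, test_function Omega phi ->
    \int[mu]_(x in Omega) (partial i phi x * a x + phi x * b x) = 0) ->
  \int[mu]_(x in Omega) (D x ord0 i * a x + w x * b x) = 0.
Proof.
move=> ap Lw LD La Lb H; apply: eq0_small => e e0.
have e2 : 0 < e / 2 by rewrite divr_gt0.
have [d1 d10 h1] := L2_pairing_small mO La e2.
have [d2 d20 h2] := L2_pairing_small mO Lb e2.
have d0 : 0 < Num.min d1 d2 by rewrite lt_min d10.
have [phi tp [p1 p2]] := ap _ d0.
have Lp := test_L2 tp; have Ldp := test_L2 (test_partial i tp).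
have L1 := L2B mO Ldp LD; have L3 := L2B mO Lp Lw.
have I1 := itg_norm (L2_mul_itg mO L1 La).
have I2 := itg_norm (L2_mul_itg mO L3 Lb).
apply: (@Rintegral_approx _ (fun x => partial i phi x * a x + phi x * b x)
  (fun x => `|(partial i phi x - D x ord0 i) * a x| + `|(phi x - w x) * b x|)).
- by apply: itgD => //; exact: L2_mul_itg.
- by apply: itgD => //; exact: L2_mul_itg.
- exact: itgD.
- move=> x _; rewrite distrC; apply: le_trans (ler_normD _ _).
  by rewrite le_eqVlt; apply/orP; left; apply/eqP; congr `|_|; ring.
- exact: H.
- rewrite RintegralD// [e]splitr; apply: lerD.
    by apply: h1 => //; apply: le_trans (p2 i) _; rewrite ge_min lexx.
  by apply: h2 => //; apply: le_trans p1 _; rewrite ge_min lexx orbT.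
Qed.

(** The product x_i w^2 is polarised as x_i phi eta with independent test functions: [E1] replaces
    phi by [w] at fixed eta, then [E2] replaces eta by [w], each step being linear. The integrand in
    [E2] is w^2 + 2 x_i w D_i, and the bound [r] keeps multiplication by x_i inside L^2. *)
Lemma approximable_poincare w D i r : approximable w D ->
  L2 mu Omega w -> L2 mu Omega (fun x => D x ord0 i) ->
  (forall x, Omega x -> `|x ord0 i| <= r) ->
  {ae mu, forall x, Omega x -> D x ord0 i = 0} ->
  {ae mu, forall x, Omega x -> w x = 0}.
Proof.
move=> ap Lw LD Or D0.
have mx : measurable_fun Omega (fun x : 'rV[R]_n => x ord0 i : R).
  by apply: measurable_funTS; exact: measurable_coord.
have Lx f : L2 mu Omega f -> L2 mu Omega (fun x => f x * x ord0 i).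
  by move=> Lf; apply: (@L2_bounded _ _ _ mu _ mO _ _ r).
have E1 eta : test_function Omega eta ->
    \int[mu]_(x in Omega) (D x ord0 i * (eta x * x ord0 i) +
      w x * (eta x + partial i eta x * x ord0 i)) = 0.
  move=> te; have Le := test_L2 te; have Lde := test_L2 (test_partial i te).
  apply: approximable_linear => //; first exact: Lx.
    by apply: L2D => //; exact: Lx.
  move=> phi tp.
  have tpe := test_smul (test_smooth tp) te.
  have tx := test_smul (smooth_coord i) tpe.
  rewrite -(test_integral_partial0 i oO tx).
  apply: eq_Rintegral => x _.
  rewrite (partialM _ _ (smooth_coord i) (test_smooth tpe)).
  rewrite (partialM _ _ (test_smooth tp) (test_smooth te)).
  have -> : partial i (fun y : 'rV[R]_n => y ord0 i) x = 1.
    by have [_] := is_derive_coord i i x; rewrite /partial => ->; rewrite eqxx.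
  by ring.
have E2 : \int[mu]_(x in Omega) (D x ord0 i * (w x * x ord0 i) +
      w x * (w x + D x ord0 i * x ord0 i)) = 0.
  apply: approximable_linear => //; first exact: Lx.
    by apply: L2D => //; exact: Lx.
  move=> eta te; rewrite -(E1 _ te); apply: eq_Rintegral => x _; ring.
have I2 : itg mu Omega (fun x => w x ^+ 2) by case: Lw.
have I1 : itg mu Omega (fun x => D x ord0 i * (w x * x ord0 i) +
      w x * (w x + D x ord0 i * x ord0 i)).
  apply: itgD => //; apply: L2_mul_itg => //; first exact: Lx.
  by apply: L2D => //; exact: Lx.
have E3 : (\int[mu]_(x in Omega) `|(w x ^+ 2)%:E| = 0)%E.
  transitivity (\int[mu]_(x in Omega) (w x ^+ 2)%:E)%E.
    by apply: eq_integral => x _; rewrite gee0_abs// lee_fin sqr_ge0.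
  rewrite -[RHS](congr1 EFin E2) EFin_Rintegral//.
  apply: ae_eq_integral => //; [exact: measurable_int I2|exact: measurable_int I1|].
  apply: filterS D0 => x h Ox; congr EFin; rewrite h//; ring.
have := (ae_eq_integral_abs mu mO (measurable_int _ I2)).1 E3.
apply: filterS => x h Ox; have := h Ox => /= -[] /eqP.
by rewrite sqrf_eq0 => /eqP.
Qed.

(** The weak gradient of [v] is tested against phi psi, and phi then tends to [w]. Of the limit
    terms v D psi, v w (d psi) and w E psi, the middle one is killed by v w = 0; as psi is
    arbitrary, the fundamental lemma concludes. *)
Lemma approximable_truncation w v D E i : approximable w D ->
  L2 mu Omega w -> L2 mu Omega (fun x => D x ord0 i) ->
  L2 mu Omega v -> L2 mu Omega (fun x => E x ord0 i) ->
  (forall psi, test_function Omega psi ->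
    \int[mu]_(x in Omega) (v x * partial i psi x) =
    - \int[mu]_(x in Omega) (E x ord0 i * psi x)) ->
  (forall x, v x * w x = 0) ->
  {ae mu, forall x, Omega x -> v x * D x ord0 i + w x * E x ord0 i = 0}.
Proof.
move=> ap Lw LD Lv LE wv vw0.
have Ig : itg mu Omega (fun x => v x * D x ord0 i + w x * E x ord0 i).
  by apply: itgD => //; exact: L2_mul_itg.
apply: (fundamental_lemma oO Ig) => psi tp.
have Ldp := test_partial i tp.
(* A term containing v w = 0 is inserted, so that the integrand has the shape required by
   [approximable_linear]. *)
transitivity (\int[mu]_(x in Omega) (D x ord0 i * (v x * psi x) +
    w x * (v x * partial i psi x + E x ord0 i * psi x))).
  apply: eq_Rintegral => x _.
  by rewrite mulrDr [w x * (v x * _)]mulrA [w x * v x]mulrC vw0; ring.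
apply: approximable_linear => //; first exact: L2_mul_test.
  by apply: L2D => //; exact: L2_mul_test.
move=> phi tphi; have tpp := test_smul (test_smooth tphi) tp.
have I1 : itg mu Omega (fun x => v x * partial i (fun x => phi x * psi x) x).
  by apply: L2_mul_itg => //; apply: test_L2; exact: test_partial.
have I2 : itg mu Omega (fun x => E x ord0 i * (phi x * psi x)).
  by apply: L2_mul_itg => //; exact: test_L2.
transitivity (\int[mu]_(x in Omega) (v x * partial i (fun x => phi x * psi x) x +
    E x ord0 i * (phi x * psi x))).
  apply: eq_Rintegral => x _.
  by rewrite (partialM _ _ (test_smooth tphi) (test_smooth tp)); ring.
by rewrite RintegralD// wv// addNr.
Qed.

End sobolev_calculus.

(** * The weak gradient on the zero set *)

Section ratio.
Context (R : realType).
Implicit Types (c s t a : R).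

Lemma ler_normM (a b A B : R) : `|a| <= A -> `|b| <= B -> `|a * b| <= A * B.
Proof. by move=> aA bB; rewrite normrM ler_pM. Qed.

Lemma ratio_gt0 a : 0 < (1 + a ^+ 2)^-1.
Proof. by rewrite invr_gt0 ltr_pwDl// sqr_ge0. Qed.

Lemma ratio_le1 a : (1 + a ^+ 2)^-1 <= 1.
Proof. by rewrite invf_le1 ?lerDl ?sqr_ge0// ltr_pwDl// sqr_ge0. Qed.

Lemma ratioE a : (1 + a ^+ 2)^-1 * a ^+ 2 = 1 - (1 + a ^+ 2)^-1.
Proof. by field; rewrite gt_eqF// ltr_pwDl// sqr_ge0. Qed.

Lemma ratio_mul_le a : `|a * (1 + a ^+ 2)^-1| <= 2^-1.
Proof.
rewrite normrM [`|_^-1|]gtr0_norm ?ratio_gt0// ler_pdivrMr ?ltr_pwDl ?sqr_ge0//.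
have h1 := sqr_ge0 (a - 1); have h2 := sqr_ge0 (a + 1).
by rewrite ler_norml; apply/andP; split; nra.
Qed.

Lemma ratio_lip c s t : 0 <= c ->
  `|(1 + (c * s) ^+ 2)^-1 - (1 + (c * t) ^+ 2)^-1| <= c * `|s - t|.
Proof.
move=> c0; set a := c * s; set b := c * t.
have hA : 1 + a ^+ 2 != 0 by rewrite gt_eqF// ltr_pwDl// sqr_ge0.
have hB : 1 + b ^+ 2 != 0 by rewrite gt_eqF// ltr_pwDl// sqr_ge0.
have -> : (1 + a ^+ 2)^-1 - (1 + b ^+ 2)^-1 =
    (b - a) * (a * (1 + a ^+ 2)^-1 * (1 + b ^+ 2)^-1 +
               b * (1 + b ^+ 2)^-1 * (1 + a ^+ 2)^-1).
  by field; rewrite hA hB.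
have -> : c * `|s - t| = `|b - a| * (2^-1 * 1 + 2^-1 * 1).
  rewrite distrC -[in LHS](ger0_norm c0) -normrM mulrBr -/a -/b.
  by rewrite mulr1 -splitr mul1r || (by field).
apply: ler_normM => //; apply: le_trans (ler_normD _ _) _.
apply: lerD; apply: ler_normM; rewrite ?ratio_mul_le// gtr0_norm ?ratio_gt0//;
  exact: ratio_le1.
Qed.

(* The error made by replacing [w], with gradient [d], by a test function [phi]
   when testing the weak gradient of [w] against [psi / (1 + (c w)^2)]. *)
Lemma truncation_diff c C w d phi dphi psi dpsi r r' K : 0 <= c ->
  `|psi| <= C -> `|dpsi| <= C ->
  r = (1 + (c * w) ^+ 2)^-1 -> r' = (1 + (c * phi) ^+ 2)^-1 -> K = 4 * c * C ->
  `|(w * dpsi * r - 2 * psi * d * (1 - r) * r + d * psi * r) -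
    (w * (r' * dpsi + psi * (- 2 * ((c * phi) * (c * dphi)) * (r' * r'))) +
     d * (psi * r'))| <=
  `|(phi - w) * (K * (`|w| + `|d|))| + `|(dphi - d) * (K * w)|.
Proof.
move=> c0 pC dpC rE r'E KE.
have C0 : 0 <= C by apply: le_trans pC.
have K0 : 0 <= K by rewrite KE !mulr_ge0.
have rr : `|r - r'| <= c * `|phi - w| by rewrite [`|phi - w|]distrC rE r'E; exact: ratio_lip.
have r0 : 0 < r by rewrite rE ratio_gt0.
have r1 : r <= 1 by rewrite rE ratio_le1.
have r'0 : 0 < r' by rewrite r'E ratio_gt0.
have r'1 : r' <= 1 by rewrite r'E ratio_le1.
(* Grouping c phi with one factor [r'] gives |q| <= c whatever the size of phi, because |a| / (1 +
   a^2) <= 1/2. *)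
pose q := - 2 * c * ((c * phi) * r') * r'.
have qc : `|q| <= c.
  rewrite /q -[leRHS]mulr1; apply: ler_normM; last by rewrite gtr0_norm.
  have h : `|- 2 * c * ((c * phi) * r')| <= 2 * c * 2^-1.
    apply: ler_normM; last by rewrite r'E ratio_mul_le.
    by rewrite mulNr normrN ger0_norm// mulr_ge0.
  by apply: le_trans h _; rewrite mulrAC divff ?mul1r.
have pq : phi * q = - 2 * ((1 - r') * r').
  by have := ratioE (c * phi); rewrite -r'E => <-; rewrite /q; ring.
have -> : (w * dpsi * r - 2 * psi * d * (1 - r) * r + d * psi * r) -
    (w * (r' * dpsi + psi * (- 2 * ((c * phi) * (c * dphi)) * (r' * r'))) +
     d * (psi * r')) =
    (w * dpsi) * (r - r') + (d * psi) * (r - r') +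
    (psi * d) * (- 2) * ((r - r') * (1 - r - r')) +
    (psi * d) * ((phi - w) * q) + (psi * w) * (q * (d - dphi)).
  have -> : (psi * d) * ((phi - w) * q) = psi * d * (phi * q) - psi * d * w * q by ring.
  by rewrite pq /q; ring.
set e1 := `|phi - w|; set e2 := `|dphi - d|.
(* The terms in |d| carry the coefficients 1 + 2 + 1 in front of c C e1, hence the 4 in [K]. The
   terms in |w| use only 1 out of 4, and the surplus 3 is the nonnegative remainder dropped
   below. *)
have -> : `|(phi - w) * (K * (`|w| + `|d|))| + `|(dphi - d) * (K * w)| =
   `|w| * C * (c * e1) + `|d| * C * (c * e1) + C * `|d| * 2 * (c * e1 * 1) +
   C * `|d| * (e1 * c) + C * `|w| * (c * e2) + (3 * c * C * (e1 * `|w| + e2 * `|w|)).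
  have KN : `|K| = K by exact: ger0_norm.
  have h1 : `|(phi - w) * (K * (`|w| + `|d|))| = e1 * (K * (`|w| + `|d|)).
    by rewrite normrM normrM KN (ger0_norm (addr_ge0 (normr_ge0 w) (normr_ge0 d))).
  have h2 : `|(dphi - d) * (K * w)| = e2 * (K * `|w|) by rewrite !normrM KN.
  by rewrite h1 h2 KE; ring.
rewrite -[leLHS]addr0; apply: lerD; last first.
  by apply: mulr_ge0; [rewrite !mulr_ge0|rewrite addr_ge0 ?mulr_ge0 ?normr_ge0].
have e2E : `|d - dphi| <= e2 by rewrite distrC.
have b1 : `|1 - r - r'| <= 1 by rewrite ler_norml; apply/andP; split; lra.
have two : `|- 2 : R| <= 2 by rewrite normrN ger0_norm.
apply: le_trans (ler_normD _ _) _; apply: lerD; last first.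
  by apply: ler_normM; exact: ler_normM.
apply: le_trans (ler_normD _ _) _; apply: lerD; last first.
  by apply: ler_normM; exact: ler_normM.
apply: le_trans (ler_normD _ _) _; apply: lerD; last first.
  apply: ler_normM; last exact: ler_normM.
  by apply: ler_normM => //; exact: ler_normM.
apply: le_trans (ler_normD _ _) _; apply: lerD.
  by apply: ler_normM => //; exact: ler_normM.
by apply: ler_normM => //; exact: ler_normM.
Qed.

End ratio.

Section level_set.
Context (R : realType) (n : nat) (Omega : set 'rV[R]_n).
Hypothesis oO : open Omega.
Local Notation mu := (@lebesgue_rV R n).
Hypothesis Ofin : (mu Omega < +oo)%E.

Let mO : measurable Omega. Proof. exact: open_measurable_rV. Qed.

Lemma approximable_level0 (w : 'rV[R]_n -> R) (D : 'rV[R]_n -> 'rV[R]_n) i :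
  approximable Omega w D ->
  L2 mu Omega w -> L2 mu Omega (fun x => D x ord0 i) ->
  (forall psi, test_function Omega psi ->
    \int[mu]_(x in Omega) (w x * partial i psi x) =
    - \int[mu]_(x in Omega) (D x ord0 i * psi x)) ->
  {ae mu, forall x, Omega x -> w x = 0 -> D x ord0 i = 0}.
Proof.
move=> ap Lw LD wD.
have mw : measurable_fun Omega w by case: Lw.
have mD : measurable_fun Omega (fun x => D x ord0 i) by case: LD.
have mrat (c : R) (f : 'rV[R]_n -> R) : measurable_fun Omega f ->
    measurable_fun Omega (fun x => (1 + (c * f x) ^+ 2)^-1).
  move=> mf.
  have cr : continuous (fun s : R => (1 + (c * s) ^+ 2)^-1).
    move=> s.
    have : (1 + (c * s) ^+ 2) @[s --> s] --> 1 + (c * s) ^+ 2.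
      under eq_fun do rewrite expr2.
      rewrite expr2; apply: cvgD; first exact: cvg_cst.
      by apply: cvgM; apply: cvgMr; exact: cvg_id.
    by apply: cvgV; rewrite gt_eqF// ltr_pwDl// sqr_ge0.
  by apply: (@measurableT_comp _ _ _ _ _ _ (fun s : R => (1 + (c * s) ^+ 2)^-1)) => //;
    exact: continuous_measurable_fun.
(* Formally this is w times the derivative of psi r, plus D_i psi r. The derivative of r contributes
   -2 c^2 w D_i r^2, and c^2 w^2 r = 1 - r absorbs the powers of c. As c grows, r tends to the
   indicator of w = 0, and only D_i psi on that set survives. *)
pose T (psi : 'rV[R]_n -> R) (c : R) x :=
  let r := (1 + (c * w x) ^+ 2)^-1 in
  w x * partial i psi x * r - 2 * psi x * D x ord0 i * (1 - r) * r +
  D x ord0 i * psi x * r.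
have IT psi c : test_function Omega psi -> itg mu Omega (T psi c).
  move=> tp; have Lp := test_L2 oO Ofin tp.
  have Ldp := test_L2 oO Ofin (test_partial i tp).
  have mr := mrat c _ mw.
  have rb x : Omega x -> `|(1 + (c * w x) ^+ 2)^-1| <= 1.
    by move=> _; rewrite gtr0_norm ?ratio_gt0// ratio_le1.
  apply: itgD => //; first apply: itgB => //.
  - apply: (@itg_mul_bounded _ _ _ _ _ mO 1) => //.
    exact: L2_mul_itg.
  - apply: (@itg_mul_bounded _ _ _ _ _ mO 1) => //.
    apply: (@itg_mul_bounded _ _ _ _ _ mO 1) => //.
    + have := itgZ mO 2 (L2_mul_itg mO Lp LD).
      by under eq_fun do rewrite mulrA.
    + by apply: measurable_funB.
    + move=> x _; rewrite ler_norml; have := ratio_gt0 (c * w x).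
      by have := ratio_le1 (c * w x) => h1 h2; apply/andP; split; lra.
  - apply: (@itg_mul_bounded _ _ _ _ _ mO 1) => //.
    exact: L2_mul_itg.
(* The dependence on w through r is not linear, so [approximable_linear] cannot be used. For a test
   function phi, psi / (1 + (c phi)^2) is an admissible test function; [truncation_diff] bounds the
   cost of putting w for phi while c stays fixed. *)
have T0 psi (k : nat) : test_function Omega psi ->
    \int[mu]_(x in Omega) T psi k%:R x = 0.
  move=> tp; have [C1 [C10 hC1]] := test_bounded tp.
  have [C2 [C20 hC2]] := test_bounded (test_partial i tp).
  pose C := C1 + C2.
  have pC x : `|psi x| <= C by rewrite (le_trans (hC1 x))// lerDl.
  have dpC x : `|partial i psi x| <= C by rewrite (le_trans (hC2 x))// lerDr.
  pose c : R := k%:R; have c0 : 0 <= c by rewrite ler0n.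
  pose K := 4 * c * C.
  have Lw1 : L2 mu Omega (fun x => K * (`|w x| + `|D x ord0 i|)).
    by apply: L2Z => //; apply: L2D => //; exact: L2_norm.
  have Lw2 : L2 mu Omega (fun x => K * w x) by exact: L2Z.
  apply: eq0_small => e e0; have e2 : 0 < e / 2 by rewrite divr_gt0.
  have [d1 d10 h1] := L2_pairing_small mO Lw1 e2.
  have [d2 d20 h2] := L2_pairing_small mO Lw2 e2.
  have d0 : 0 < Num.min d1 d2 by rewrite lt_min d10.
  have [phi tphi [p1 p2]] := ap _ d0.
  have Lp := test_L2 oO Ofin tphi.
  have Ldp := test_L2 oO Ofin (test_partial i tphi).
  have sc : smooth (fun x => c * phi x).
    by move=> l; apply: CkZ; exact: (test_smooth tphi).
  have trp : test_function Omega (fun x => (1 + (c * phi x) ^+ 2)^-1 * psi x).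
    by apply: test_smul => // l; exact: Ck_ratio.
  have dr x : partial i (fun x => (1 + (c * phi x) ^+ 2)^-1 * psi x) x =
      (1 + (c * phi x) ^+ 2)^-1 * partial i psi x +
      psi x * (- 2 * ((c * phi x) * (c * partial i phi x)) *
        ((1 + (c * phi x) ^+ 2)^-1 * (1 + (c * phi x) ^+ 2)^-1)).
    rewrite partialM; [|by move=> l; exact: Ck_ratio|exact: test_smooth tp].
    have [_ dphi _] := CkS_inv (test_smooth tphi 1%N).
    have h := dphi i x.
    have hc := is_deriveZ c h.
    have [_ hr] := is_derive_ratio hc.
    by rewrite [X in _ + _ * X]hr.
  pose g x := w x * ((1 + (c * phi x) ^+ 2)^-1 * partial i psi x +
      psi x * (- 2 * ((c * phi x) * (c * partial i phi x)) *
        ((1 + (c * phi x) ^+ 2)^-1 * (1 + (c * phi x) ^+ 2)^-1))) +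
      D x ord0 i * (psi x * (1 + (c * phi x) ^+ 2)^-1).
  have gE : g = fun x => w x * partial i (fun x => (1 + (c * phi x) ^+ 2)^-1 * psi x) x +
      D x ord0 i * ((1 + (c * phi x) ^+ 2)^-1 * psi x).
    by apply/funext => x; rewrite dr /g; ring.
  have Ltrp := test_L2 oO Ofin trp.
  have Ldtrp := test_L2 oO Ofin (test_partial i trp).
  have Ig1 := L2_mul_itg mO Lw Ldtrp; have Ig2 := L2_mul_itg mO LD Ltrp.
  have Lpw := L2B mO Lp Lw; have LdpD := L2B mO Ldp LD.
  have I1 := itg_norm (L2_mul_itg mO Lpw Lw1).
  have I2 := itg_norm (L2_mul_itg mO LdpD Lw2).
  apply: (@Rintegral_approx _ _ _ oO _ g (fun x =>
     `|(phi x - w x) * (K * (`|w x| + `|D x ord0 i|))| +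
     `|(partial i phi x - D x ord0 i) * (K * w x)|)).
  - exact: IT.
  - by rewrite gE; exact: (itgD mO Ig1 Ig2).
  - exact: itgD.
  - by move=> x _; exact: (truncation_diff _ _ _ (pC x) (dpC x) erefl erefl erefl).
  - rewrite gE.
    by rewrite RintegralD// wD// addNr.
  - rewrite RintegralD// [e]splitr; apply: lerD.
      by apply: h1 => //; apply: le_trans p1 _; rewrite ge_min lexx.
    by apply: h2 => //; apply: le_trans (p2 i) _; rewrite ge_min lexx orbT.
have mw0 : measurable_fun Omega (fun x => (w x == 0)%:R : R).
  rewrite (_ : (fun x => _) = \1_[set 0 : R] \o w).
    by apply: measurableT_comp => //; exact: measurable_indic.
  apply/funext => x /=; rewrite indicE.
  by case: eqP => h; [rewrite mem_set|rewrite memNset].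
have Ig : itg mu Omega (fun x => D x ord0 i * (w x == 0)%:R).
  apply: (@itg_mul_bounded _ _ _ _ _ mO 1) => //; first exact: (L2_itg mO Ofin LD).
  by move=> x _; case: eqP => _; rewrite ?normr0 ?normr1.
have := fundamental_lemma oO Ig; case => [psi tp|Z [mZ Z0 ZP]]; last first.
  exists Z; split => // x hx; apply: ZP => h; apply: hx => Ox w0.
  by have := h Ox; rewrite w0 eqxx mulr1.
have Lp := test_L2 oO Ofin tp.
have Ldp := test_L2 oO Ofin (test_partial i tp).
have I1 := itg_norm (L2_mul_itg mO Lw Ldp).
have I2 := itg_norm (L2_mul_itg mO LD Lp).
have cvT : {ae mu, forall x, Omega x -> (T psi k%:R x)%:E @[k --> \oo] -->
    (D x ord0 i * (w x == 0)%:R * psi x)%:E}.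
  apply: aeW => x _; apply: cvg_EFin; first exact: nearW.
  have cr := @ratio_cvg R (w x).
  rewrite (_ : D x ord0 i * _ * _ =
    w x * partial i psi x * (w x == 0)%:R -
    2 * psi x * D x ord0 i * (1 - (w x == 0)%:R) * (w x == 0)%:R +
    D x ord0 i * psi x * (w x == 0)%:R); last first.
    by case: eqP => [->|_]; rewrite ?mulr1n ?mulr0n; ring.
  apply: cvgD; last exact: cvgMr.
  apply: cvgB; first exact: cvgMr.
  apply: cvgM => //; apply: cvgMr; apply: cvgB => //; exact: cvg_cst.
(* Of the factor 3, a part 2 comes from the derivative of the ratio and a part 1 from the last term;
   no k enters the bound. *)
have domT : {ae mu, forall x k, Omega x -> (`|(T psi k%:R x)%:E| <=
    (`|w x * partial i psi x| + 3 * `|D x ord0 i * psi x|)%:E)%E}.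
  apply: aeW => x k _; rewrite /= lee_fin /T.
  set r := _^-1; have r0 : 0 < r := ratio_gt0 _; have r1 : r <= 1 := ratio_le1 _.
  have r2 : `|r| <= 1 by rewrite gtr0_norm.
  have r3 : `|1 - r| <= 1 by rewrite ler_norml; apply/andP; split; lra.
  apply: le_trans (ler_normD _ _) _.
  rewrite (_ : 3 * _ = 2 * `|D x ord0 i * psi x| * 1 * 1 + `|D x ord0 i * psi x| * 1);
    last by ring.
  rewrite addrA; apply: lerD; last exact: ler_normM.
  apply: le_trans (ler_normB _ _) _; apply: lerD.
    by rewrite -[leRHS]mulr1; exact: ler_normM.
  apply: ler_normM => //; apply: ler_normM => //.
  by rewrite -mulrA normrM (@ger0_norm _ 2)// [psi x * _]mulrC.
have [_ _] := @dominated_convergence _ _ R mu Omega mO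
   (fun k x => (T psi k%:R x)%:E)
   (EFin \o (fun x => D x ord0 i * (w x == 0)%:R * psi x))
   (EFin \o (fun x => `|w x * partial i psi x| + 3 * `|D x ord0 i * psi x|))
   (fun k => measurable_int _ (IT psi k%:R tp))
   ((measurable_EFinP _ _).2 (measurable_funM (itg_measurable Ig) (proj1 Lp)))
   cvT (itgD mO I1 (itgZ mO 3 I2)) domT.
under eq_fun do rewrite -(EFin_Rintegral mO (IT psi _ tp)) T0//.
move=> /(cvg_lim (@ereal_hausdorff _)); rewrite lim_cst// => h.
by rewrite /Rintegral -h.
Qed.

End level_set.

(** * Euler's identity for the anisotropic norm *)

(** The difference quotients at 0 are nonpositive on the left and nonnegative on the right. *)
Lemma is_derive_min0 (R : realType) (f : R -> R) (d : R) :
  is_derive (0 : R) 1 f d -> f 0 = 0 -> (\forall t \near (0 : R), 0 <= f t) ->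
  d = 0.
Proof.
move=> [df <-] f0 fge0; apply/eqP; rewrite eq_le.
have C : h^-1 *: f h @[h --> (0 : R)^'] --> 'D_1 f 0.
  rewrite /derive; move: df; rewrite /derivable f0.
  rewrite (_ : (fun h => _ *: _) = (fun h => h^-1 *: f h))//.
  by apply/funext => h /=; rewrite subr0 addr0 [h%:A]mulr1.
have Ll : \forall t \near (0 : R)^'-, 0 <= f t.
  by rewrite near_withinE; apply: filterS fge0.
have Lr : \forall t \near (0 : R)^'+, 0 <= f t.
  by rewrite near_withinE; apply: filterS fge0.
apply/andP; split.
- apply: (cvgr_to_le (cvg_dnbhs_at_left C)).
  near=> h; have h0 : h < 0 by [].
  rewrite /GRing.scale/= mulr_le0_ge0// ?invr_le0 ?(ltW h0)//.
  by near: h; exact: Ll.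
- apply: (cvgr_to_ge (cvg_dnbhs_at_right C)).
  near=> h; have h0 : 0 < h by [].
  rewrite /GRing.scale/= mulr_ge0// ?invr_ge0 ?(ltW h0)//.
  by near: h; exact: Lr.
Unshelve. all: by end_near. Qed.

Section norm.
Context (R : realType) (N : nat) (F : 'rV[R]_N -> R).
Hypothesis (N2 : (2 <= N)%N) (anF : anisotropic_norm F).

Lemma anisotropic0 : F 0 = 0.
Proof. by rewrite -(scale0r (0 : 'rV[R]_N)) (F_homo anF) normr0 mul0r. Qed.

(** Convexity at the midpoint, rescaled by homogeneity. *)
Lemma anisotropic_subadditive x y : F (x + y) <= F x + F y.
Proof.
have h2 : (2 : R) * (1 - 2^-1) = 1 by field.
have : F (2^-1 *: x + (1 - 2^-1) *: y) <= 2^-1 * F x + (1 - 2^-1) * F y.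
  have i0 : (0 : R) <= 2^-1 by rewrite invr_ge0.
  have i1 : 2^-1 <= (1 : R) by rewrite invf_le1// ler1n.
  exact: (@F_convex _ _ _ anF (Itv01 i0 i1) x y (in_setT _) (in_setT _)).
have -> : 2^-1 *: x + (1 - 2^-1) *: y = 2^-1 *: (x + y).
  by rewrite scalerDr; congr (_ + _ *: _); field.
rewrite (F_homo anF) gtr0_norm ?invr_gt0//; lra.
Qed.

Lemma anisotropic_sum (I : Type) (s : seq I) (f : I -> 'rV[R]_N) :
  F (\sum_(i <- s) f i) <= \sum_(i <- s) F (f i).
Proof.
elim/big_rec2 : _ => [|i x y _ h]; first by rewrite anisotropic0.
by apply: le_trans (anisotropic_subadditive _ _) _; rewrite lerD2l.
Qed.

Lemma anisotropic_le (x : 'rV[R]_N) : F x <= \sum_i F (delta_mx ord0 i) * `|x ord0 i|.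
Proof.
rewrite {1}(row_sum_delta x); apply: le_trans (anisotropic_sum _ _) _.
by apply: ler_sum => i _; rewrite (F_homo anF) mulrC.
Qed.

Lemma anisotropic_derivable x i : x != 0 -> derivable F x (delta_mx ord0 i).
Proof. by move=> x0; have [_ /(_ i)[h _]] := F_C2 anF; exact: h. Qed.

(* Convexity gives [(1 + t) F x <= N^-1 \sum_i F (x + N t x_i e_i)], with
   equality at [t = 0]; hence the derivatives at [0] agree, which is Euler's
   identity and needs only the partial derivatives of [F]. *)
Lemma anisotropic_euler x : x != 0 -> dotp (grad F x) x = F x.
Proof.
move=> x0; pose nn : R := N%:R.
have nn0 : nn != 0 by rewrite pnatr_eq0 -lt0n (ltnW N2).
have nnp : 0 < nn by rewrite ltr0n (ltnW N2).
pose g i (s : R) := F (s *: delta_mx ord0 i + x).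
pose th t := nn^-1 * \sum_i g i (nn * x ord0 i * t) - (1 + t) * F x.
suff : dotp (grad F x) x - F x = 0 by move/eqP; rewrite subr_eq0 => /eqP.
apply: (@is_derive_min0 _ th).
- have dg i : is_derive (0 : R) 1 (fun t => g i (nn * x ord0 i * t))
      (partial i F x * (nn * x ord0 i)).
    apply: is_derive_comp_dir.
    + have := is_deriveZ (nn * x ord0 i) (is_derive_id (0 : R) 1).
      by rewrite [_ *: 1]mulr1.
    + rewrite mulr0; have /is_derive_line hF := derivableP (@anisotropic_derivable x i x0).
      exact: hF.
  have ds := is_derive_sum dg.
  have dl : is_derive (0 : R) 1 (fun t : R => (1 + t) * F x) (F x).
    have := is_deriveM (is_deriveD (is_derive_cst (1 : R) (0 : R) 1) (is_derive_id (0 : R) 1))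
      (is_derive_cst (F x) (0 : R) 1).
    by rewrite scaler0 !add0r [_ *: _]mulr1.
  have := is_deriveB (is_deriveZ nn^-1 ds) dl.
  rewrite (_ : _ *: _ - _ = dotp (grad F x) x - F x).
    rewrite (_ : (_ - _) = th)//.
    by apply/funext => t; rewrite /th /= fct_sumE.
  congr (_ - _); rewrite /dotp /GRing.scale/= mulr_sumr.
  by apply: eq_bigr => i _; rewrite mxE; field.
- rewrite /th (eq_bigr (fun=> F x)).
    by rewrite sumr_const card_ord addr0 -[F x *+ N]mulr_natl mulrA mulVf// subrr.
  by move=> i _; rewrite /g mulr0 scale0r add0r.
- near=> t.
  have t1 : -1 < t by near: t; apply: lt_nbhsr; rewrite oppr_lt0.
  have t2 : 0 < 1 + t by lra.
  rewrite /th subr_ge0 -{1}(gtr0_norm t2) -(F_homo anF).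
  have -> : (1 + t) *: x = \sum_i nn^-1 *: ((nn * x ord0 i * t) *: delta_mx ord0 i + x).
    rewrite -scaler_sumr big_split/= sumr_const card_ord -scaler_nat scalerDr.
    rewrite scalerA mulVf// scale1r scalerDl scale1r addrC; congr (_ + _).
    rewrite scaler_sumr {1}(row_sum_delta x) scaler_sumr; apply: eq_bigr => i _.
    by rewrite !scalerA; congr (_ *: _); field.
  apply: le_trans (anisotropic_sum _ _) _; rewrite mulr_sumr; apply: ler_sum => i _.
  by rewrite (F_homo anF) gtr0_norm ?invr_gt0.
Unshelve. all: by end_near. Qed.

Lemma QN_flux_dot x : dotp (QN_flux F x) x = F x ^+ N.
Proof.
rewrite /QN_flux; case: eqVneq => [->|x0].
  rewrite anisotropic0 expr0n gtn_eqF ?(ltnW N2)// /dotp big1// => i _.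
  by rewrite !mxE mul0r.
have N0 : (0 < N)%N by exact: ltnW.
transitivity (F x ^+ N.-1 * dotp (grad F x) x).
  by rewrite /dotp mulr_sumr; apply: eq_bigr => i _; rewrite mxE mulrA.
by rewrite anisotropic_euler// -exprSr prednK.
Qed.

Lemma measurable_QN_flux i :
  measurable_fun [set: 'rV[R]_N] (fun x => QN_flux F x ord0 i : R).
Proof.
pose U := [set x : 'rV[R]_N | x != 0].
have oU : open U.
  rewrite (_ : U = ~` [set 0]); last by apply/seteqP; split => x /= /eqP.
  by apply: closed_openC; apply: compact_closed => //; exact: compact_set1.
have [cF /(_ i)[_ [cdF _]]] := F_C2 anF.
have mU := open_measurable_rV oU.
have mg : measurable_fun U (fun x => F x ^+ N.-1 * partial i F x).
  apply: measurable_funM; last exact: open_continuous_measurable_rV.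
  by apply: measurable_funX; exact: open_continuous_measurable_rV.
rewrite (_ : (fun x => _) = (fun x => F x ^+ N.-1 * partial i F x) \_ U).
  by apply/(measurable_restrictT _ mU).
apply/funext => x; rewrite patchE /QN_flux; case: eqVneq => [->|x0].
  by rewrite memNset ?mxE// /U/= eqxx.
by rewrite mem_set// !mxE.
Qed.

End norm.

(** * The maximum principle *)

Section flux_integral.
Context (R : realType) (N : nat) (F : 'rV[R]_N -> R) (Omega : set 'rV[R]_N).
Hypothesis (N2 : (2 <= N)%N) (anF : anisotropic_norm F) (oO : open Omega).
Local Notation mu := (@lebesgue_rV R N).

Let mO : measurable Omega. Proof. exact: open_measurable_rV. Qed.

Lemma measurable_QN_flux_dot (A B : 'rV[R]_N -> 'rV[R]_N) :
  (forall i, measurable_fun Omega (fun x => A x ord0 i)) ->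
  (forall i, measurable_fun Omega (fun x => B x ord0 i)) ->
  measurable_fun Omega (fun x => dotp (QN_flux F (A x)) (B x)).
Proof.
move=> mA mB; rewrite /dotp; apply: measurable_sum => i.
apply: measurable_funM => //.
(* [A] is measurable on Omega only; its extension by 0 is measurable everywhere and can be composed
   with the flux. *)
pose A' x : 'rV[R]_N := \row_j ((fun x => A x ord0 j) \_ Omega) x.
have mA' : measurable_fun setT A'.
  apply: measurable_fun_coordP => j; rewrite (_ : (fun x => _) =
      (fun x => A x ord0 j) \_ Omega); last by apply/funext => x; rewrite mxE.
  by apply/(measurable_restrictT _ mO).
apply: (eq_measurable_fun (fun x => QN_flux F (A' x) ord0 i)).
  move=> x xO; congr (QN_flux F _ ord0 i); apply/rowP => j.
  by rewrite mxE patchE xO.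
apply: measurable_funTS.
exact: (measurableT_comp (@measurable_QN_flux _ _ _ anF i) mA').
Qed.

(** F(x) is at most N times the largest of the terms F(e_i) |x_i|, and the N-th power of that bound
    is one summand on the right. This serves to integrate F(D)^N. *)
Lemma anisotropic_pow_le (x : 'rV[R]_N) :
  F x ^+ N <= \sum_i (N%:R * F (delta_mx ord0 i)) ^+ N * `|x ord0 i| ^+ N.
Proof.
pose b i := F (delta_mx ord0 i) * `|x ord0 i|.
have b0 i : 0 <= b i by rewrite mulr_ge0// (F_ge0 anF).
have i0 : 'I_N by exact: (Ordinal (ltnW N2)).
have [j jmax] : exists j, forall i, b i <= b j.
  have /= := @arg_maxP _ _ _ i0 xpredT b erefl.
  by case=> j _ h; exists j => i; exact: h.
have Fx : F x <= N%:R * b j.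
  apply: le_trans (anisotropic_le anF x) _; apply: (@le_trans _ _ (\sum_(i < N) b j)).
    by apply: ler_sum => i _; exact: jmax.
  by rewrite sumr_const card_ord mulr_natl.
apply: (@le_trans _ _ ((N%:R * b j) ^+ N)).
  by rewrite lerXn2r ?nnegrE ?(F_ge0 anF)// mulr_ge0.
rewrite /b mulrA exprMn (bigD1 j)//= lerDl sumr_ge0// => i _.
by rewrite mulr_ge0 ?exprn_ge0// mulr_ge0// (F_ge0 anF).
Qed.

Lemma itg_anisotropic_pow (D : 'rV[R]_N -> 'rV[R]_N) :
  (forall i, Lp Omega N%:R (fun x => D x ord0 i)) ->
  itg mu Omega (fun x => F (D x) ^+ N).
Proof.
move=> LD; have LDi i := Lp_itg oO (ltnW N2) (LD i).
apply: (itg_le mO _ (g := fun x => \sum_i (N%:R * F (delta_mx ord0 i)) ^+ N *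
    `|D x ord0 i| ^+ N)).
- rewrite (_ : (fun x => _) = (fun x => dotp (QN_flux F (D x)) (D x))).
    by apply: measurable_QN_flux_dot => i; case: (LDi i).
  by apply/funext => x; rewrite QN_flux_dot.
- by move=> x _; rewrite ger0_norm ?anisotropic_pow_le// exprn_ge0// (F_ge0 anF).
- rewrite /itg (_ : EFin \o _ = fun x => (\sum_i ((N%:R * F (delta_mx ord0 i)) ^+ N *
    `|D x ord0 i| ^+ N)%:E)%E); last by apply/funext => x /=; rewrite sumEFin.
  apply: integrable_sum => // i _; apply: itgZ => //; by case: (LDi i).
Qed.

(** Under the dichotomy the integrand equals the pairing of the flux of [D] with [D], that is
    F(D)^N, almost everywhere; both sides vanish where D = 0. A nonnegative function with
    nonpositive integral is 0 almost everywhere, and F vanishes only at the origin. *)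
Lemma flux_integral_le0 (A D : 'rV[R]_N -> 'rV[R]_N) :
  (forall i, Lp Omega N%:R (fun x => A x ord0 i)) ->
  (forall i, Lp Omega N%:R (fun x => D x ord0 i)) ->
  {ae mu, forall x, Omega x -> D x = 0 \/ A x = D x} ->
  \int[mu]_(x in Omega) dotp (QN_flux F (A x)) (D x) <= 0 ->
  {ae mu, forall x, Omega x -> D x = 0}.
Proof.
move=> LA LD AD le0.
have mA i : measurable_fun Omega (fun x => A x ord0 i).
  by case: (Lp_itg oO (ltnW N2) (LA i)).
have mD i : measurable_fun Omega (fun x => D x ord0 i).
  by case: (Lp_itg oO (ltnW N2) (LD i)).
have IF := itg_anisotropic_pow LD.
have FD0 x : 0 <= F (D x) ^+ N by rewrite exprn_ge0// (F_ge0 anF).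
have E : (\int[mu]_(x in Omega) (dotp (QN_flux F (A x)) (D x))%:E =
    \int[mu]_(x in Omega) (F (D x) ^+ N)%:E)%E.
  apply: ae_eq_integral => //.
  - by apply/measurable_EFinP; exact: measurable_QN_flux_dot.
  - exact: measurable_int IF.
  - apply: filterS AD => x h Ox; congr EFin; rewrite -(QN_flux_dot N2 anF).
    have [Dx|->//] := h Ox.
    by rewrite Dx /dotp !big1// => i _; rewrite !mxE mulr0.
have I0 : \int[mu]_(x in Omega) (F (D x) ^+ N) = 0.
  apply/eqP; rewrite eq_le Rintegral_ge0 ?andbT//.
  by move: le0; rewrite /Rintegral E.
have E0 : (\int[mu]_(x in Omega) `|(F (D x) ^+ N)%:E| = 0)%E.
  transitivity (\int[mu]_(x in Omega) (F (D x) ^+ N)%:E)%E.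
    by apply: eq_integral => x _; rewrite gee0_abs// lee_fin.
  by rewrite -EFin_Rintegral// I0.
have := (ae_eq_integral_abs mu mO (measurable_int _ IF)).1 E0.
apply: filterS => x h Ox; have := h Ox => /= -[] /eqP.
rewrite expf_eq0 => /andP[_ /eqP Fx]; apply/eqP; apply: contraT => Dx.
by have := F_gt0 anF Dx; rewrite Fx ltxx.
Qed.

End flux_integral.

(** * The weak gradient of the positive part *)

Section positive_part.
Context (R : realType) (n p : nat) (Omega : set 'rV[R]_n).
Hypotheses (p2 : (2 <= p)%N) (oO : open Omega).
Local Notation mu := (@lebesgue_rV R n).
Hypothesis Ofin : (mu Omega < +oo)%E.

Let mO : measurable Omega. Proof. exact: open_measurable_rV. Qed.

(** Here [v] is the minimum of u - M and 0, so v w = 0 pointwise. Where w is nonzero, v = 0 and the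
    truncation identity reduces to w (Du - D) = 0; where w = 0, [approximable_level0] gives D =
    0. *)
Lemma weak_gradient_positive_part u Du M D :
  sobolev Omega p%:R u Du ->
  sobolev0 Omega p%:R (fun x => Num.max (u x - M) 0) D ->
  {ae mu, forall x, Omega x -> D x = 0 \/ Du x = D x}.
Proof.
move=> [Lu LDu wu] s0; have ap := sobolev0_approximable oO Ofin p2 s0.
move: s0 => [[Lw LD ww] _]; set w := (fun x => Num.max (u x - M) 0) in Lw ww ap *.
pose v x := u x - M - w x.
pose E x := Du x - D x.
have {}Lu := Lp_L2 oO Ofin p2 Lu; have {}Lw := Lp_L2 oO Ofin p2 Lw.
have {}LDu i := Lp_L2 oO Ofin p2 (LDu i); have {}LD i := Lp_L2 oO Ofin p2 (LD i).
have Lv : L2 mu Omega v.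
  by apply: L2B => //; apply: L2B => //; exact: L2_cst.
have EE x i : E x ord0 i = Du x ord0 i - D x ord0 i by rewrite !mxE.
have LE i : L2 mu Omega (fun x => E x ord0 i).
  by under eq_fun do rewrite EE; exact: L2B.
have wv psi i : test_function Omega psi ->
    \int[mu]_(x in Omega) (v x * partial i psi x) =
    - \int[mu]_(x in Omega) (E x ord0 i * psi x).
  move=> tp; have Lp := test_L2 oO Ofin tp.
  have Ldp := test_L2 oO Ofin (test_partial i tp).
  have I1 := L2_mul_itg mO Lu Ldp; have I2 := L2_mul_itg mO Lw Ldp.
  have I3 := itgZ mO M (L2_itg mO Ofin Ldp).
  have J1 := L2_mul_itg mO (LDu i) Lp; have J2 := L2_mul_itg mO (LD i) Lp.
  transitivity (\int[mu]_(x in Omega) (u x * partial i psi x -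
      M * partial i psi x - w x * partial i psi x)).
    by apply: eq_Rintegral => x _; rewrite /v; ring.
  rewrite RintegralB//; last exact: itgB.
  rewrite RintegralB// RintegralZl//; last exact: (L2_itg mO Ofin Ldp).
  (* The constant [M] contributes nothing, since the integral of a partial derivative of a test
     function is 0. *)
  rewrite (test_integral_partial0 i oO tp) mulr0 subr0 wu// ww//.
  have -> : \int[mu]_(x in Omega) (E x ord0 i * psi x) =
      \int[mu]_(x in Omega) (Du x ord0 i * psi x - D x ord0 i * psi x).
    by apply: eq_Rintegral => x _; rewrite EE mulrBl.
  by rewrite RintegralB//; ring.
have vw0 x : v x * w x = 0.
  rewrite /v /w; case: (leP (u x - M) 0) => h; first by rewrite mulr0.
  by rewrite subrr mul0r.
have A1 i := approximable_truncation oO Ofin ap Lw (LD i) Lv (LE i) (wv ^~ i) vw0.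
have A2 i := approximable_level0 oO Ofin ap Lw (LD i) (fun psi => ww psi i).
have {}A1 : {ae mu, forall x, forall i, Omega x ->
    v x * D x ord0 i + w x * E x ord0 i = 0}.
  by apply: filter_forall => i; exact: A1.
have {}A2 : {ae mu, forall x, forall i, Omega x -> w x = 0 -> D x ord0 i = 0}.
  by apply: filter_forall => i; exact: A2.
apply: filterS2 A1 A2 => x h1 h2 Ox.
have [w0|w0] := eqVneq (w x) 0.
  by left; apply/rowP => i; rewrite h2// mxE.
right; apply/rowP => i; have := h1 i Ox.
have v0 : v x = 0 by apply/eqP; have := vw0 x => /eqP; rewrite mulf_eq0 (negbTE w0) orbF.
by rewrite v0 mul0r add0r => /eqP; rewrite mulf_eq0 (negbTE w0)/= EE subr_eq0 => /eqP.
Qed.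

End positive_part.

Theorem theorem3p1 (R : realType) (N : nat) (F : 'rV[R]_N -> R)
    (Omega : set 'rV[R]_N) (M : R) (u : 'rV[R]_N -> R) :
  (2 <= N)%N ->
  anisotropic_norm F ->
  domain Omega -> bounded_set Omega ->
  QN_subsolution F Omega u ->
  boundary_le Omega N%:R u M ->
  {ae @lebesgue_rV R N, forall x, Omega x -> u x <= M}.
Proof.
move=> N2 anF [oO _ _] bO [Du [su sub]] [D s0].
have mO := open_measurable_rV oO; have Ofin := bounded_lty mO bO.
have [r [r0 hr]] := bounded_set_coord bO.
have LDu := let: And3 _ h _ := su in h.
have [[Lw LD _] _] := s0.
have AD := weak_gradient_positive_part N2 oO Ofin su s0.
have D0 : {ae @lebesgue_rV R N, forall x, Omega x -> D x = 0}.
  apply: (flux_integral_le0 N2 anF oO LDu LD AD); apply: sub s0 _.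
  by apply: aeW => x _; rewrite le_max lexx orbT.
(* The Poincare argument takes place in a single direction, and N >= 2 provides the index 0. *)
pose i0 : 'I_N := Ordinal (ltnW N2).
have D0i : {ae @lebesgue_rV R N, forall x, Omega x -> D x ord0 i0 = 0}.
  by apply: filterS D0 => x h Ox; rewrite h// mxE.
have w0 := approximable_poincare oO Ofin (sobolev0_approximable oO Ofin N2 s0)
  (Lp_L2 oO Ofin N2 Lw) (Lp_L2 oO Ofin N2 (LD i0)) (fun x => hr x i0) D0i.
apply: filterS w0 => x h Ox; have := h Ox.
by rewrite -subr_le0; case: leP => // h1 h2; rewrite h2 ltxx in h1.
Qed.
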